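(* Let $\omega$ be a concave, strictly increasing modulus of continuity with $\omega(\infty)=\infty$, and let $\theta(t):=\int_0^t\omega(s)\,ds$. Given an arbitrary nonempty subset $E$ of $\mathbb{R}^n$, a linear subspace $X\subset\mathbb{R}^n$, the orthogonal projection $P:=P_{X}:\mathbb{R}^n\to X$, and two functions $f:E \to \mathbb{R}$, $G: E \to \mathbb{R}^n$, the following is true. There exists a convex function $F:\mathbb{R}^n\to\mathbb{R}$ of class $C^{1, \omega}_{\mathrm{loc}}$ such that $F_{|_E}=f$, $(\nabla F)_{|_E} =G$, and $X_{F}=X$, if and only if the following conditions are satisfied. (i) $Y:=\mathrm{span}\left(\{G(y)-G(z) : y, z\in E\}\right)\subseteq X$. (ii) If $k:=\dim Y< d:= \dim X$, then there exist points $p_1, \ldots, p_{d-k} \in \mathbb{R}^n \setminus E$, numbers $\beta_1,\ldots, \beta_{d-k} \in \mathbb{R}$, and vectors $w_1, \ldots, w_{d-k} \in \mathbb{R}^n$ such that for every $y\in E^{*}:=E\cup\{p_1, \ldots, p_{d-k}\}$ there exists a (not necessarily convex) function $\varphi_{y}:X\to [0, \infty)$ of class $C^{1, \omega}_{\mathrm{loc}}$ such that, denoting $t_y:=f(y)$ and $\xi_y:=G(y)$ for $y\in E$; $t_y:=\beta_j$ and $\xi_y:=w_j$ for $y=p_j$, $j=1, \ldots, d-k$, we have that: $$\mathrm{span}\{\xi_y-\xi_z : y,z \in E^{*}\}=X;$$ $$\varphi_{y}(P(y))=0,\quad \nabla\varphi_{y}(P(y))=0\quad\text{for every } y\in E^*;$$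 $$\sup\left\{\frac{|\nabla\varphi_{y}(u)-\nabla\varphi_{y}(v)|}{\omega(|u-v|)} \, : \, y\in E^{*}\cap P^{-1}(B_{X}(0, R)),\ u, v\in B_{X}(0, R),\ u\neq v \right\}<\infty$$ for every $R>0$; and $$t_z+\langle \xi_z, x-z\rangle \leq t_y +\langle \xi_y, x-y\rangle +\varphi_{y}(P(x))$$ for every $z, y \in E^{*}$ and every $x\in \mathbb{R}^n$. (iii) If $k=d$, then the preceding condition holds with $E$ in place of $E^{*}$ (no need to add new data). Moreover, whenever these conditions are satisfied, for every number $a>0$ the formula $$F=\mathrm{conv}\left(x\mapsto \inf_{y\in E^{*}}\left\{t_y+ \langle\xi_y, x-y\rangle+\varphi_{y}(P(x))+a\,\theta\left(|P(x-y)|\right)\right\}\right)$$ (with $E^*=E$ if $k=d$) defines a $C^{1, \omega}_{\mathrm{loc}}$ convex extension of the jet $(f, G)$ to $\mathbb{R}^n$ (that is, $F=f$, $\nabla F=G$ on $E$) which satisfies $X_F=X$.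
   Context: $|\cdot|$, $\langle\cdot,\cdot\rangle$ are the Euclidean norm and inner product. A modulus of continuity is a nondecreasing continuous function $\omega:[0,\infty)\to[0,\infty)$ with $\omega(0)=0$; $\omega(\infty)=\infty$ means $\lim_{t\to\infty}\omega(t)=\infty$. $C^{1,\omega}_{\mathrm{loc}}$ is the class of differentiable functions $F$ such that for every ball $B$ there is a constant $M$ with $|\nabla F(x)-\nabla F(y)|\le M\omega(|x-y|)$ for all $x,y\in B$. $B_X(0,r)$ is the closed ball of center $0$ and radius $r$ in $X$. A supremum over the empty set of nonnegative quantities is $0$. $\mathrm{conv}(g)(x)=\sup\{\varphi(x) : \varphi \text{ convex}, \varphi\leq g\}$ is the convex envelope of $g:\mathbb{R}^n\to\mathbb{R}$. For a convex function $F:\mathbb{R}^n\to\mathbb{R}$, $X_F:=\mathrm{span}\{u-w : u\in\partial F(x), w\in\partial F(y), x,y\in\mathbb{R}^n\}$, where $\partial F$ is the subdifferential; for differentiable $F$, $X_F=\mathrm{span}\{\nabla F(x)-\nabla F(y): x,y\in\mathbb{R}^n\}$. *)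

(* Defs.v *)
From HB Require Import structures.
From mathcomp Require Import all_boot all_order all_algebra.
From mathcomp Require Import all_classical all_reals all_analysis.
Import Order.TTheory GRing.Theory Num.Theory.
Import numFieldNormedType.Exports.

Set Implicit Arguments.
Unset Strict Implicit.
Unset Printing Implicit Defensive.

Local Open Scope classical_set_scope.
Local Open Scope ring_scope.

(* The library norm on ['rV[R]_n] is the sup norm; it only serves to provide
   the topology (hence [differentiable]).  All quantitative conditions use the
   Euclidean norm below. *)
Definition dot (R : realType) (n : nat) (x y : 'rV[R]_n) : R :=
  \sum_(i < n) x 0 i * y 0 i.

(* A linear subspace [X] of R^n as a normed space of its own: [subvs_of X] with
   the norm, hence the topology, induced by ['rV[R]_n]. *)
Section SubspaceNorm.
Variables (R : realType) (n : nat) (X : {vspace 'rV[R]_n}).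

Lemma sub_norm_triangle (u v : subvs_of X) :
  `|vsval (u + v)| <= `|vsval u| + `|vsval v|.
Proof. by rewrite linearD; exact: ler_normD. Qed.

Lemma sub_normZ (a : R) (u : subvs_of X) : `|vsval (a *: u)| = `|a| * `|vsval u|.
Proof. by rewrite linearZ; exact: normrZ. Qed.

Lemma sub_norm0_eq0 (u : subvs_of X) : `|vsval u| = 0 -> u = 0.
Proof. by move=> /normr0_eq0 u0; apply/val_inj; exact: u0. Qed.

HB.instance Definition _ := Lmodule_isNormed.Build R (subvs_of X)
  sub_norm_triangle sub_normZ sub_norm0_eq0.

Definition sdot (u v : subvs_of X) : R := dot (vsval u) (vsval v).

End SubspaceNorm.

Section InnerProduct.
Variables (R : realType) (V : normedModType R) (ip : V -> V -> R).
Implicit Types (F : V -> R) (x y g : V).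

Definition enorm x : R := Num.sqrt (ip x x).

(* The Riesz representative of the differential ([rV_gradientP] and
   [sub_gradientP] below). *)
Definition gradient F x : V :=
  xget 0 [set g | forall v, 'd F x v = ip g v].

Definition C1omega_loc (omega : R -> R) F : Prop :=
  (forall x, differentiable F x) /\
  forall (c : V) (r : R), exists M : R, forall x y,
    enorm (x - c) <= r -> enorm (y - c) <= r ->
    enorm (gradient F x - gradient F y) <= M * omega (enorm (x - y)).

End InnerProduct.

Section Modulus.
Variables (R : realType) (omega : R -> R).

(* A modulus is represented by a function on [R], of which only the values on
   [0, +oo[ are ever used. *)
Definition modulus_of_continuity : Prop :=
  [/\ omega 0 = 0,
      (forall t, 0 <= t -> 0 <= omega t),
      {in `[0, +oo[ &, {homo omega : s t / s <= t}}
    & {within `[0, +oo[, continuous omega}].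

Definition concave_modulus : Prop :=
  @convex_function R R^o `[0, +oo[ (fun t => - omega t).

Definition theta (t : R) : R :=
  \int[lebesgue_measure]_(s in `[0, t]) omega s.

End Modulus.

Section Euclidean.
Variables (R : realType) (n : nat).
Local Notation E_n := 'rV[R]_n.

Definition vspan_spec (S : set E_n) (U : {vspace E_n}) : Prop :=
  (forall x, S x -> x \in U) /\
  (forall W : {vspace E_n}, (forall x, S x -> x \in W) -> (U <= W)%VS).

(* The least subspace containing [S]; it exists by [vspanP]. *)
Definition vspan (S : set E_n) : {vspace E_n} := xget 0%VS (vspan_spec S).

(* The point of [X] given by [orthprojP]. *)
Definition orthproj (X : {vspace E_n}) (x : E_n) : subvs_of X :=
  xget 0 [set p | forall v : subvs_of X, dot (x - vsval p) (vsval v) = 0].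

Definition convex_fun (F : E_n -> R) : Prop := @convex_function R E_n setT F.

Definition convex_envelope (g : E_n -> R) (x : E_n) : R :=
  sup [set phi x | phi in [set phi | convex_fun phi /\ forall z, phi z <= g z]].

Definition subdifferential (F : E_n -> R) (x : E_n) : set E_n :=
  [set u | forall z, F x + dot u (z - x) <= F z].

Definition X_of (F : E_n -> R) : {vspace E_n} :=
  vspan [set v | exists x y u w,
    [/\ subdifferential F x u, subdifferential F y w & v = u - w]].

Definition diff_span (E : set E_n) (xi : E_n -> E_n) : {vspace E_n} :=
  vspan [set xi y - xi z | y in E & z in E].

(* The datum [f y] for [y] in [E], and [b j] for [y = p j].  The condition
   [diff_span _ _ = X] of [jet_condition] forces the points [p j] to be
   pairwise distinct when there are [\dim X - \dim Y] of them, so the choice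
   made by [pick] is immaterial there. *)
Definition extend_data (T : Type) (m : nat) (E : set E_n) (f : E_n -> T)
    (p : 'I_m -> E_n) (b : 'I_m -> T) (y : E_n) : T :=
  if y \in E then f y
  else if [pick j | p j == y] is Some j then b j else f y.

Definition holder_ratios (omega : R -> R) (X : {vspace E_n}) (E : set E_n)
    (phi : E_n -> subvs_of X -> R) (r : R) : set (\bar R) :=
  [set q | exists (y : E_n) (u v : subvs_of X),
    [/\ E y /\ enorm (@sdot R n X) (orthproj X y) <= r,
        enorm (@sdot R n X) u <= r,
        enorm (@sdot R n X) v <= r,
        u != v
      & q = (enorm (@sdot R n X)
               (gradient (@sdot R n X) (phi y) u -
                gradient (@sdot R n X) (phi y) v)
             / omega (enorm (@sdot R n X) (u - v)))%:E]].

Definition jet_condition (omega : R -> R) (X : {vspace E_n}) (E : set E_n)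
    (t : E_n -> R) (xi : E_n -> E_n) (phi : E_n -> subvs_of X -> R) : Prop :=
  let P := orthproj X in
  [/\ diff_span E xi = X,
      (forall y, E y ->
        [/\ forall u, 0 <= phi y u,
            C1omega_loc (@sdot R n X) omega (phi y),
            phi y (P y) = 0
          & gradient (@sdot R n X) (phi y) (P y) = 0]),
      (forall r : R, 0 < r -> (ereal_sup (holder_ratios omega E phi r) < +oo)%E)
    & forall z y, E z -> E y -> forall x,
        t z + dot (xi z) (x - z) <= t y + dot (xi y) (x - y) + phi y (P x)].

(* The real-valued [inf] and the [sup] in [convex_envelope] are the true ones
   under [jet_condition]: its last clause bounds the family below by an affine
   function of [x]. *)
Definition extension_formula (omega : R -> R) (X : {vspace E_n}) (E : set E_n)
    (t : E_n -> R) (xi : E_n -> E_n) (phi : E_n -> subvs_of X -> R) (a : R) :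
    E_n -> R :=
  let P := orthproj X in
  convex_envelope (fun x => inf [set
    t y + dot (xi y) (x - y) + phi y (P x)
      + a * theta omega (enorm (@sdot R n X) (P (x - y))) | y in E]).

Definition is_extension (omega : R -> R) (X : {vspace E_n}) (E : set E_n)
    (f : E_n -> R) (G : E_n -> E_n) (F : E_n -> R) : Prop :=
  [/\ convex_fun F,
      C1omega_loc (@dot R n) omega F,
      (forall y, E y -> F y = f y),
      (forall y, E y -> gradient (@dot R n) F y = G y)
    & X_of F = X].

End Euclidean.

Section WellDefined.
Variables (R : realType) (n : nat).
Implicit Types (S : set 'rV[R]_n) (X U W : {vspace 'rV[R]_n}).

Lemma vspan_unique S U W : vspan_spec S U -> vspan_spec S W -> U = W.
Proof.
move=> [SU U_min] [SW W_min]; apply/eqP; rewrite eqEsubv.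
by rewrite U_min // W_min.
Qed.

Lemma vspanP S : vspan_spec S (vspan S).
Proof.
suff [U HU] : exists U, vspan_spec S U.
  exact: (xgetPex 0%VS (ex_intro _ U HU)).
pose pd d := `[< exists s : seq 'rV[R]_n,
  (forall x, x \in s -> S x) /\ \dim (span s) = d >].
have pd0 : exists d, pd d.
  by exists 0%N; apply/asboolP; exists [::]; rewrite span_nil dimv0.
have pdb d : pd d -> (d <= \dim {:'rV[R]_n})%N.
  by move=> /asboolP[s [_ <-]]; rewrite dimvS ?subvf.
case: (ex_maxnP pd0 pdb) => d /asboolP[s [sS sd]] dmax.
exists (span s); split => [x Sx|W SW].
  have : (\dim (span (x :: s)) <= \dim (span s))%N.
    rewrite sd; apply: dmax; apply/asboolP; exists (x :: s); split=> // z.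
    by rewrite inE => /predU1P[->//|/sS].
  move=> le_dim; have : span s == span (x :: s).
    by rewrite eqEdim le_dim andbT span_cons addvSr.
  by move=> /eqP ->; rewrite memv_span // mem_head.
by apply/span_subvP => x /sS /SW.
Qed.

Lemma dotC (x y : 'rV[R]_n) : dot x y = dot y x.
Proof. by apply: eq_bigr => i _; rewrite mulrC. Qed.

Lemma dotDl (a : R) (x y z : 'rV[R]_n) :
  dot (a *: x + y) z = a * dot x z + dot y z.
Proof.
rewrite /dot mulr_sumr -big_split; apply: eq_bigr => i _ /=.
by rewrite !mxE mulrDl mulrA.
Qed.

Lemma dotBl (x y z : 'rV[R]_n) : dot (x - y) z = dot x z - dot y z.
Proof. by rewrite addrC -scaleN1r dotDl mulN1r addrC. Qed.

Lemma dot_eq0 (x : 'rV[R]_n) : dot x x = 0 -> x = 0.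
Proof.
move=> /eqP; rewrite psumr_eq0 => [/allP x0|i _]; last by rewrite -expr2 sqr_ge0.
apply/rowP => i; rewrite mxE; have := x0 i (mem_index_enum _).
by rewrite mulf_eq0 orbb => /eqP.
Qed.

Lemma sub_riesz X (l : {linear subvs_of X -> R^o}) :
  exists g : subvs_of X, forall v, l v = sdot g v.
Proof.
pose b := vbasis {:subvs_of X}.
pose T (u : subvs_of X) : 'rV[R]_(\dim {:subvs_of X}) := \row_i sdot u b`_i.
have Tlin : linear T.
  by move=> a u v; apply/rowP => i; rewrite !mxE /sdot linearP /= dotDl.
pose Tl := GRing.isLinear.Build _ _ _ _ T Tlin.
pose TL : {linear subvs_of X -> 'rV[R]_(\dim {:subvs_of X})} := HB.pack T Tl.
have ext (h k : {linear subvs_of X -> R^o}) :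
    (forall i : 'I_(\dim {:subvs_of X}), h b`_i = k b`_i) -> h =1 k.
  move=> hk v; rewrite (coord_vbasis (memvf v)) !linear_sum /=.
  by apply: eq_bigr => i _; rewrite !linearZ /= hk.
pose sd (u : subvs_of X) (v : subvs_of X) : R^o := sdot u v.
have sdlin u : linear (sd u).
  by move=> a v w; rewrite /sd /sdot linearP /= dotC dotDl !(dotC _ (vsval u)).
pose SD u : {linear subvs_of X -> R^o} :=
  HB.pack (sd u) (GRing.isLinear.Build _ _ _ _ (sd u) (sdlin u)).
have kerT : lker (linfun TL) == 0%VS.
  rewrite -subv0; apply/subvP => u; rewrite memv_ker memv0 lfunE /= => /eqP Tu0.
  have s0 v : sdot 0 v = 0 by rewrite /sdot /dot big1 // => j _; rewrite mxE mul0r.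
  have SD0 : SD u =1 SD 0.
    by apply: ext => i; have /rowP/(_ i) := Tu0; rewrite !mxE /= /sd s0.
  by apply/eqP/val_inj/dot_eq0; have := SD0 u; rewrite /= /sd s0.
have : (\row_i l b`_i) \in limg (linfun TL).
  suff -> : limg (linfun TL) = fullv by rewrite memvf.
  apply/eqP; rewrite eqEdim subvf /= limg_dim_eq ?(eqP kerT) ?capv0 //.
  by rewrite !dimvf /dim /= mul1n.
move=> /memv_imgP[g _ gE]; exists g => v.
apply: (ext l (SD g)) => i; have /rowP/(_ i) := gE.
by rewrite lfunE /= !mxE.
Qed.

Lemma sub_riesz_unique X (g h : subvs_of X) :
  (forall v, sdot g v = sdot h v) -> g = h.
Proof.
move=> gh; apply/eqP; rewrite -subr_eq0; apply/eqP/val_inj/dot_eq0.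
by rewrite linearB /= dotBl -(linearB (vsval : _ -> _)) -!/(sdot _ _) gh subrr.
Qed.

Lemma sub_gradientP X (F : subvs_of X -> R) (u v : subvs_of X) :
  'd F u v = sdot (gradient (@sdot R n X) F u) v.
Proof.
have : exists g, [set g | forall w, 'd F u w = sdot g w] g.
  by have [g gE] := sub_riesz ('d F u); exists g.
by move=> /(xgetPex 0); apply.
Qed.

Lemma rV_gradientP (F : 'rV[R]_n -> R) (x v : 'rV[R]_n) :
  'd F x v = dot (gradient (@dot R n) F x) v.
Proof.
have : exists g, [set g | forall w, 'd F x w = dot g w] g.
  exists (\row_i 'd F x (delta_mx 0 i)) => w /=.
  rewrite [in LHS](row_sum_delta w) linear_sum; apply: eq_bigr => i _ /=.
  by rewrite linearZ mxE mulrC.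
by move=> /(xgetPex 0); apply.
Qed.

Lemma orthprojP X (x : 'rV[R]_n) (v : subvs_of X) :
  dot (x - vsval (orthproj X x)) (vsval v) = 0.
Proof.
pose h (w : subvs_of X) : R^o := dot x (vsval w).
have h_lin : linear h.
  by move=> a u w; rewrite /h linearP /= dotC dotDl !(dotC _ x).
pose H : {linear subvs_of X -> R^o} :=
  HB.pack h (GRing.isLinear.Build _ _ _ _ h h_lin).
have [g gE] := sub_riesz H.
have : exists p : subvs_of X,
    [set p | forall w : subvs_of X, dot (x - vsval p) (vsval w) = 0] p.
  by exists g => w /=; rewrite dotBl -/(sdot g w) -gE subrr.
by move=> /(xgetPex 0); apply.
Qed.

End WellDefined.

(* Main.v *)
(* If [F] is a convex extension with gradient differences in [X], the remainders
   phi_y(u) = F(u) - F(Py) - <grad F(y), u - Py>, u in X, satisfy the conditions,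
   because F(x + v) = F(x) + <grad F(y), v> whenever v is orthogonal to X; the
   points p_j are chosen one by one so that grad F(p_j) - grad F(y_0) leaves the
   space spanned so far.

   Conversely, let g be the infimum in the extension formula and F = conv(g).
   The term a theta(|P(x - y)|) forces near-optimal y to stay close to x modulo
   the kernel of P, so g(w + v) + g(w - v) - 2 g(w) <= C |v| omega(|v|) locally.
   If x = sum_i l_i x_i nearly realizes conv(g)(x), then sum_i l_i |P x_i| is
   bounded: the tangents of the jet lie below g, and differences of their slopes
   span X.  So half of the mass sits at points with P x_i bounded, and shifting
   only these gives the same estimate for F, with another C.  A convex function
   with such second differences is C^{1,omega}_loc. *)

Require Import Defs.
From HB Require Import structures.
From mathcomp Require Import all_boot all_order all_algebra.
From mathcomp Require Import all_classical all_reals all_analysis.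
From mathcomp Require Import ring lra.
Import Order.TTheory GRing.Theory Num.Theory.
Import numFieldNormedType.Exports.

Set Implicit Arguments.
Unset Strict Implicit.
Unset Printing Implicit Defensive.

Local Open Scope classical_set_scope.
Local Open Scope ring_scope.

(** * Euclidean geometry and orthogonal projections *)

(** The obstacle is that [g] is controlled only where [P w] stays bounded, while the envelope at [x]
    averages values of [g] at points that may be arbitrarily far away. Distance along the kernel of
    [P] is harmless: all slopes [xi y] agree there, so [g] is affine in those directions and no
    constant sees them. In the directions of [X], the first-moment bound and Markov's inequality
    leave a mass [L >= 1/2] within reach; moving it by [v / L], at most twice [v], moves the average
    by [v], and [omega (2 t) <= 2 omega t] keeps the modulus. Affinity along the kernel also puts
    every subgradient of [F] in [xi y0 + X], hence [X_F] in [X]; the other inclusion holds because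
    [xi y] is a subgradient of [F] at [y]. No infimum needs to be attained: an error of at most 1 is
    enough for the bounds, and an arbitrarily small one for the inequalities. *)

Section EuclideanGeometry.
Variables (R : realType) (n : nat).
Implicit Types (x y z v : 'rV[R]_n) (X : {vspace 'rV[R]_n}).
Local Notation nrm := (enorm (@dot R n)).

Lemma dotD x y z : dot (x + y) z = dot x z + dot y z.
Proof. by rewrite -[x]scale1r dotDl mul1r scale1r. Qed.

Lemma dotZ a x z : dot (a *: x) z = a * dot x z.
Proof.
by rewrite /dot mulr_sumr; apply: eq_bigr => i _; rewrite mxE mulrA.
Qed.

Lemma dotN x z : dot (- x) z = - dot x z.
Proof. by rewrite -scaleN1r dotZ mulN1r. Qed.

Lemma dot0 x : dot 0 x = 0.
Proof. by rewrite -(scale0r 0) dotZ mul0r. Qed.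

Lemma dotDr x y z : dot x (y + z) = dot x y + dot x z.
Proof. by rewrite !(dotC x) dotD. Qed.

Lemma dotZr a x z : dot x (a *: z) = a * dot x z.
Proof. by rewrite !(dotC x) dotZ. Qed.

Lemma dotNr x z : dot x (- z) = - dot x z.
Proof. by rewrite !(dotC x) dotN. Qed.

Lemma dotBr x y z : dot x (y - z) = dot x y - dot x z.
Proof. by rewrite dotDr dotNr. Qed.

Lemma dot0r x : dot x 0 = 0.
Proof. by rewrite dotC dot0. Qed.

Lemma dot_sumr (I : Type) (r : seq I) (P : pred I) (u : I -> 'rV[R]_n) x :
  dot x (\sum_(i <- r | P i) u i) = \sum_(i <- r | P i) dot x (u i).
Proof.
by apply: (big_morph (dot x)) => [y z|]; [exact: dotDr|exact: dot0r].
Qed.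

Lemma dot_ge0 x : 0 <= dot x x.
Proof. by apply: sumr_ge0 => i _; rewrite -expr2 sqr_ge0. Qed.

Lemma enorm_sqr x : nrm x ^+ 2 = dot x x.
Proof. by rewrite sqr_sqrtr // dot_ge0. Qed.

Lemma enorm_ge0 x : 0 <= nrm x.
Proof. exact: sqrtr_ge0. Qed.

Lemma enorm0 : nrm 0 = 0.
Proof. by rewrite /enorm dot0 sqrtr0. Qed.

Lemma enorm_eq0 x : nrm x = 0 -> x = 0.
Proof. by move=> x0; apply: dot_eq0; rewrite -enorm_sqr x0 expr0n. Qed.

Lemma enorm_gt0 x : x != 0 -> 0 < nrm x.
Proof.
move=> x0; rewrite lt_neqAle enorm_ge0 andbT eq_sym.
by apply: contra_neq x0; exact: enorm_eq0.
Qed.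

Lemma enormZ a x : nrm (a *: x) = `|a| * nrm x.
Proof.
by rewrite /enorm dotZ dotZr mulrA -expr2 sqrtrM ?sqr_ge0 // sqrtr_sqr.
Qed.

Lemma enormN x : nrm (- x) = nrm x.
Proof. by rewrite -scaleN1r enormZ normrN1 mul1r. Qed.

Lemma enormB x y : nrm (x - y) = nrm (y - x).
Proof. by rewrite -enormN opprB. Qed.

Lemma dot_le_enorm x y : dot x y <= nrm x * nrm y.
Proof.
have [->|y0] := eqVneq y 0; first by rewrite dot0r enorm0 mulr0.
have y_gt0 := enorm_gt0 y0; have x_ge0 := enorm_ge0 x.
have := dot_ge0 (nrm y ^+ 2 *: x - dot x y *: y).
rewrite dotBl !dotBr !dotZ !dotZr -!enorm_sqr (dotC y x) => H.
suff /ler_normlP[] : `|dot x y| <= nrm x * nrm y by [].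
rewrite -(@ler_pXn2r _ 2) ?nnegrE ?mulr_ge0 ?enorm_ge0 ?normr_ge0 //.
rewrite real_normK ?num_real // exprMn.
have y2_gt0 : 0 < nrm y ^+ 2 by rewrite exprn_gt0.
by rewrite -(ler_pM2r y2_gt0); lra.
Qed.

Lemma normr_dot_le x y : `|dot x y| <= nrm x * nrm y.
Proof.
rewrite ler_norml dot_le_enorm andbT lerNl -dotN (le_trans (dot_le_enorm _ _)) //.
by rewrite enormN.
Qed.

Lemma enormD x y : nrm (x + y) <= nrm x + nrm y.
Proof.
rewrite -(@ler_pXn2r _ 2) ?nnegrE ?addr_ge0 ?enorm_ge0 //.
rewrite sqrrD !enorm_sqr dotD !dotDr (dotC y x).
by have := dot_le_enorm x y; lra.
Qed.

Lemma ler_enormB x y : `|nrm x - nrm y| <= nrm (x - y).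
Proof.
have := enormD (x - y) y; have := enormD (y - x) x; rewrite !subrK (enormB y x).
by move=> H1 H2; rewrite ler_norml; lra.
Qed.

Lemma parallelogram x y :
  nrm (x + y) ^+ 2 + nrm (x - y) ^+ 2 = 2 * (nrm x ^+ 2 + nrm y ^+ 2).
Proof.
by rewrite !enorm_sqr dotBl dotD !dotDr !dotNr (dotC y x); ring.
Qed.

Lemma row_dot_delta x i : x 0 i = dot x (delta_mx 0 i).
Proof.
rewrite /dot (bigD1 i) //= big1 => [|j ji]; rewrite mxE eqxx /=.
  by rewrite eqxx mulr1 addr0.
by rewrite (negPf ji) mulr0.
Qed.

Lemma enorm_le_sum x : nrm x <= \sum_(i < n) `|x 0 i|.
Proof.
rewrite [in leLHS](row_sum_delta x).
apply: (big_ind2 (fun a b => nrm a <= b)) => [|a b c d ab cd|i _].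
- by rewrite enorm0.
- by rewrite (le_trans (enormD _ _)) // lerD.
rewrite enormZ; suff -> : nrm (delta_mx 0 i) = 1 by rewrite mulr1.
by rewrite /enorm -row_dot_delta mxE !eqxx sqrtr1.
Qed.

Lemma coord_le_norm x i : `|x 0 i| <= `|x|.
Proof.
rewrite [leRHS]/Num.norm /= mx_normrE; apply/bigmax_geP; right => /=.
by exists (0, i).
Qed.

Lemma enorm_le_norm x : nrm x <= n%:R * `|x|.
Proof.
rewrite (le_trans (enorm_le_sum x)) // mulr_natl.
rewrite (le_trans (ler_sum _ (fun i _ => coord_le_norm x i))) //.
by rewrite sumr_const card_ord.
Qed.

Lemma orthproj_unique X x (p : subvs_of X) :
  (forall v : subvs_of X, dot (x - vsval p) (vsval v) = 0) -> orthproj X x = p.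
Proof.
move=> xp; apply: sub_riesz_unique => v; rewrite /sdot.
have := xp v; have := orthprojP x v; rewrite !dotBl => /eqP.
by rewrite subr_eq0 => /eqP -> /eqP; rewrite subr_eq0 => /eqP.
Qed.

Lemma orthproj_is_linear X : linear (orthproj X).
Proof.
move=> a x y; apply: orthproj_unique => v; rewrite linearP /=.
rewrite addrACA -scalerDr dotDl.
by rewrite !orthprojP mulr0 addr0.
Qed.

HB.instance Definition _ X :=
  GRing.isLinear.Build R 'rV[R]_n (subvs_of X) _ (orthproj X)
    (@orthproj_is_linear X).

Lemma orthproj_id X (u : subvs_of X) : orthproj X (vsval u) = u.
Proof. by apply: orthproj_unique => v; rewrite subrr dot0. Qed.

Lemma sdot_orthproj X x (v : subvs_of X) :
  sdot (orthproj X x) v = dot x (vsval v).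
Proof.
by apply/eqP; rewrite eq_sym -subr_eq0 /sdot -dotBl orthprojP.
Qed.

Lemma enorm_orthproj X x : enorm (@sdot R n X) (orthproj X x) <= nrm x.
Proof.
rewrite -(@ler_pXn2r _ 2) ?nnegrE ?enorm_ge0 ?sqrtr_ge0 //.
rewrite -[enorm _ _]/(nrm (vsval (orthproj X x))) !enorm_sqr.
have := dot_ge0 (x - vsval (orthproj X x)); have := orthprojP x (orthproj X x).
by rewrite dotBr !dotBl (dotC _ x); lra.
Qed.

(** The residue [x - P x] lies in the kernel of [P], so it is orthogonal to [x] by assumption; being
    orthogonal to [P x] as well, it is orthogonal to itself. *)
Lemma orthproj_perp_mem X x :
  (forall v, orthproj X v = 0 -> dot x v = 0) -> x \in X.
Proof.
move=> xperp; set v := x - vsval (orthproj X x).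
have Pv : orthproj X v = 0 by rewrite linearB /= orthproj_id subrr.
have : v = 0.
  apply: dot_eq0; rewrite {1}/v dotBl (xperp _ Pv) sub0r.
  by rewrite dotC orthprojP oppr0.
by move=> /eqP; rewrite subr_eq0 => /eqP ->; exact: subvsP.
Qed.

(** Self-adjointness of [P] turns the coordinates of [P x] into the functionals [<P e_i, x>], whose
    representatives lie in [X]; such functionals are what the jet can bound. *)
Lemma enorm_orthproj_le_sum X x : enorm (@sdot R n X) (orthproj X x) <=
  \sum_(i < n) `|dot (vsval (orthproj X (delta_mx 0 i))) x|.
Proof.
rewrite (le_trans (enorm_le_sum _)) //; apply: ler_sum => i _.
rewrite row_dot_delta dotC -sdot_orthproj.
by rewrite /sdot dotC -/(sdot (orthproj X x) _) sdot_orthproj dotC.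
Qed.

Lemma orthprojD X x y : orthproj X (x + y) = orthproj X x + orthproj X y.
Proof. exact: raddfD. Qed.

Lemma orthprojB X x y : orthproj X (x - y) = orthproj X x - orthproj X y.
Proof. exact: raddfB. Qed.

Lemma orthprojZ X c x : orthproj X (c *: x) = c *: orthproj X x.
Proof. exact: linearZ. Qed.

Section Subspace.
Variable X : {vspace 'rV[R]_n}.
Local Notation snrm := (enorm (@sdot R n X)).
Implicit Types u w : subvs_of X.

Lemma vsvalD u w : vsval (u + w) = vsval u + vsval w.
Proof. exact: raddfD. Qed.

Lemma vsvalB u w : vsval (u - w) = vsval u - vsval w.
Proof. exact: raddfB. Qed.

Lemma sdotBl u1 u2 w : sdot (u1 - u2) w = sdot u1 w - sdot u2 w.
Proof. by rewrite /sdot vsvalB dotBl. Qed.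

Lemma sdot_le_enorm u w : sdot u w <= snrm u * snrm w.
Proof. exact: dot_le_enorm. Qed.

Lemma senorm_ge0 u : 0 <= snrm u.
Proof. exact: sqrtr_ge0. Qed.

Lemma senorm_gt0 u : u != 0 -> 0 < snrm u.
Proof.
move=> u0; apply: (@enorm_gt0 (vsval u)).
by apply: contra_neq u0 => u0; exact/val_inj.
Qed.

Lemma senorm0 : snrm 0 = 0.
Proof. exact: enorm0. Qed.

Lemma senormD u w : snrm (u + w) <= snrm u + snrm w.
Proof.
rewrite -[snrm (u + w)]/(nrm (vsval (u + w))) vsvalD; exact: enormD.
Qed.

Lemma senormZ c u : snrm (c *: u) = `|c| * snrm u.
Proof.
rewrite -[snrm (c *: u)]/(nrm (vsval (c *: u))) linearZ /=; exact: enormZ.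
Qed.

Lemma senormB u w : snrm (u - w) <= snrm u + snrm w.
Proof.
by rewrite (le_trans (senormD _ _)) // -scaleN1r senormZ normrN1 mul1r.
Qed.

End Subspace.

(** [Q] is a subspace given as a predicate. A subspace inside [Q] of maximal dimension contains
    every point of [Q], since adding the line of a missing point would stay in [Q] and raise the
    dimension. *)
Lemma vspan_ind (S : set 'rV[R]_n) (Q : 'rV[R]_n -> Prop) :
    Q 0 -> (forall a u v, Q u -> Q v -> Q (a *: u + v)) ->
    (forall x, S x -> Q x) ->
  forall x, x \in vspan S -> Q x.
Proof.
move=> Q0 QD SQ.
have [Qspan Qmin] := vspanP Q.
suff H : forall x, x \in vspan Q -> Q x.
  move=> x xS; apply: H; apply: subvP x xS.
  by apply: (proj2 (vspanP S)) => x /SQ /Qspan.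
pose pd d := `[< exists U : {vspace 'rV[R]_n},
  (forall x, x \in U -> Q x) /\ \dim U = d >].
have pd0 : exists d, pd d.
  exists 0%N; apply/asboolP; exists 0%VS; rewrite dimv0; split=> // x.
  by rewrite memv0 => /eqP ->.
have pdb d : pd d -> (d <= \dim {:'rV[R]_n})%N.
  by move=> /asboolP[U [_ <-]]; rewrite dimvS ?subvf.
case: (ex_maxnP pd0 pdb) => d /asboolP[U [UQ Ud]] dmax.
suff QU : forall x, Q x -> x \in U.
  by move=> x xQ; apply: UQ; apply: subvP x xQ; exact: Qmin.
move=> x Qx.
have : (\dim (U + <[x]>)%VS <= \dim U)%N.
  rewrite Ud; apply: dmax; apply/asboolP; exists (U + <[x]>)%VS; split=> // z.
  move=> /memv_addP[u uU [v /vlineP[k ->] ->]].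
  by rewrite addrC; apply: QD => //; exact: UQ.
move=> le_dim; have /eqP UE : U == (U + <[x]>)%VS by rewrite eqEdim le_dim addvSl.
by rewrite UE; apply: (subvP (addvSr _ _)); rewrite memv_line.
Qed.

End EuclideanGeometry.

(** * Concave moduli of continuity *)

Lemma convex_functionP (R : realType) (V : lmodType R) (D : set V) (F : V -> R) :
  @convex_function R V D F <->
  (forall s x y, 0 <= s -> s <= 1 -> D x -> D y ->
     F (s *: x + (1 - s) *: y) <= s * F x + (1 - s) * F y).
Proof.
split=> [cF s x y s0 s1 Dx Dy|cF s x y /set_mem Dx /set_mem Dy].
  by have := cF (Itv01 s0 s1) x y; apply; rewrite inE.
apply: cF => //.
Qed.

Section Modulus.
Variables (R : realType) (omega : R -> R).
Hypothesis omega_modulus : modulus_of_continuity omega.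

Lemma modulus0 : omega 0 = 0.
Proof. by case: omega_modulus. Qed.

Lemma modulus_ge0 t : 0 <= t -> 0 <= omega t.
Proof. by case: omega_modulus => _ + _ _; apply. Qed.

Lemma modulus_homo s t : 0 <= s -> s <= t -> omega s <= omega t.
Proof.
case: omega_modulus => _ _ om _ s0 st; apply: om => //; rewrite in_itv /= andbT //.
exact: le_trans st.
Qed.

Let mu := @lebesgue_measure R.

Lemma modulus_integrable s t : 0 <= s ->
  mu.-integrable `[s, t] (EFin \o omega).
Proof.
move=> s0; apply: continuous_compact_integrable; first exact: segment_compact.
case: omega_modulus => _ _ _; apply: continuous_subspaceW => x /=.
by rewrite !in_itv /= andbT => /andP[sx _]; exact: le_trans sx.
Qed.

Lemma thetaB s t : 0 <= s -> s <= t ->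
  theta omega t - theta omega s = \int[mu]_(x in `]s, t]) omega x.
Proof.
move=> s0 st; rewrite /theta Rintegral_itvB //.
exact: modulus_integrable.
Qed.

(** On []s, t]] the monotone [omega] stays between its end values. These bounds stand in for
    [theta' = omega] in the later estimates of [theta]. *)
Lemma theta_tangent_le s t : 0 <= s -> s <= t ->
  (t - s) * omega s <= theta omega t - theta omega s <= (t - s) * omega t.
Proof.
move=> s0 st; rewrite thetaB //.
have int_cst c : mu.-integrable `]s, t] (EFin \o cst c).
  apply: (@integrableS _ _ _ mu `[s, t]%classic) => //.
    by move=> x /=; exact: subset_itv_oc_cc.
  apply: continuous_compact_integrable; first exact: segment_compact.
  by apply: continuous_subspaceT => x; exact: cst_continuous.
have int_om : mu.-integrable `]s, t] (EFin \o omega).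
  apply: (@integrableS _ _ _ mu `[s, t]%classic) => //.
    by move=> x /=; exact: subset_itv_oc_cc.
  exact: modulus_integrable.
have cstE c : \int[mu]_(x in `]s, t]) cst c x = (t - s) * c.
  have muE : fine (lebesgue_measure (`]s, t]%classic : set R)) = t - s.
    rewrite lebesgue_measure_itv /= lte_fin; case: ltP => //= ts.
    by rewrite (@le_anti _ _ s t) ?st //= subrr.
  by rewrite Rintegral_cst // [fine _]muE mulrC.
rewrite -(cstE (omega s)) -(cstE (omega t)).
apply/andP; split; apply: le_Rintegral => // x /=; rewrite in_itv /= => /andP[sx xt].
  exact/modulus_homo/ltW.
by apply: modulus_homo => //; exact: le_trans (ltW sx).
Qed.

Lemma thetaB_le s t : 0 <= s -> 0 <= t ->
  theta omega t - theta omega s <= (t - s) * omega t.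
Proof.
move=> s0 t0; case: (leP s t) => [st|/ltW ts].
  by have /andP[] := theta_tangent_le s0 st.
by have /andP[+ _] := theta_tangent_le t0 ts; lra.
Qed.

Lemma theta0 : theta omega 0 = 0.
Proof. by rewrite /theta set_itv1 Rintegral_set1. Qed.

Lemma theta_homo s t : 0 <= s -> s <= t -> theta omega s <= theta omega t.
Proof.
move=> s0 st; rewrite -subr_ge0; have /andP[+ _] := theta_tangent_le s0 st.
by apply: le_trans; rewrite mulr_ge0 ?subr_ge0 ?modulus_ge0.
Qed.

Lemma theta_ge0 t : 0 <= t -> 0 <= theta omega t.
Proof. by move=> t0; rewrite -theta0; exact: theta_homo. Qed.

Hypothesis omega_concave : concave_modulus omega.

Lemma modulus_concave p s t : 0 <= p -> p <= 1 -> 0 <= s -> 0 <= t ->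
  p * omega s + (1 - p) * omega t <= omega (p * s + (1 - p) * t).
Proof.
move=> p0 p1 s0 t0; have /convex_functionP/(_ p s t p0 p1) := omega_concave.
rewrite /= !in_itv /= !andbT => /(_ s0 t0).
by rewrite -[p *: s]/(p * s) -[(1 - p) *: t]/((1 - p) * t); lra.
Qed.

Lemma modulus_scale p t : 0 <= p -> p <= 1 -> 0 <= t ->
  p * omega t <= omega (p * t).
Proof.
move=> p0 p1 t0; have := modulus_concave p0 p1 t0 (lexx 0).
by rewrite modulus0 !mulr0 !addr0.
Qed.

(** Concavity along the chord from the origin: [omega t / t] is nonincreasing, stated without
    division. *)
Lemma modulus_ratio s t : 0 < s -> s <= t -> s * omega t <= t * omega s.
Proof.
move=> s0 st; have t0 := lt_le_trans s0 st.
have := @modulus_scale (s / t) t; rewrite divfK ?gt_eqF //.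
rewrite divr_ge0 ?(ltW s0) ?(ltW t0) // ler_pdivrMr // mul1r => /(_ isT st isT).
by rewrite mulrAC ler_pdivrMr // (mulrC _ t).
Qed.

Lemma modulusD s t : 0 <= s -> 0 <= t -> omega (s + t) <= omega s + omega t.
Proof.
rewrite [0 <= s]le_eqVlt [0 <= t]le_eqVlt => /predU1P[<-|s0] /predU1P[<-|t0];
  rewrite ?add0r ?addr0 ?modulus0 ?add0r ?addr0 //.
have st : 0 < s + t by exact: addr_gt0.
rewrite -(ler_pM2l st).
have := @modulus_ratio s (s + t) s0; have := @modulus_ratio t (s + t) t0.
by rewrite lerDl lerDr (ltW s0) (ltW t0) => /(_ isT) + /(_ isT); lra.
Qed.

Lemma modulus_double t : 0 <= t -> omega (2 * t) <= 2 * omega t.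
Proof. by move=> t0; rewrite !mulr_natl !mulr2n; exact: modulusD. Qed.

Lemma modulusB s t : 0 <= s -> 0 <= t -> `|omega s - omega t| <= omega `|s - t|.
Proof.
wlog st : s t / s <= t => [H|] s0 t0.
  by case: (leP s t) => [|/ltW] st; last rewrite distrC (distrC s); exact: H.
have ts : 0 <= t - s by rewrite subr_ge0.
rewrite distrC (distrC s) (ger0_norm ts) ger0_norm ?subr_ge0 ?modulus_homo //.
by rewrite lerBlDr -{1}(subrK s t) modulusD.
Qed.

Hypothesis omega_strict : {in `[0, +oo[ &, {homo omega : s t / s < t}}.

Lemma modulus_gt0 t : 0 < t -> 0 < omega t.
Proof.
move=> t0; rewrite -{1}modulus0; apply: omega_strict => //;
  by rewrite in_itv /= ?lexx ?(ltW t0).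
Qed.

(** Beyond 1 the slope of [theta] is at least [omega 1 > 0], so sublevel sets are bounded; this
    converts a bound on the penalty [a theta(|P(w - y)|)] into one on [|P(w - y)|]. *)
Lemma theta_bounded (c : R) : exists K, 0 <= K /\
  forall t, 0 <= t -> theta omega t <= c -> t <= K.
Proof.
have o1 := modulus_gt0 ltr01.
exists (`|c| / omega 1 + 1); split=> [|t t0 tc].
  by rewrite addr_ge0 ?divr_ge0 ?(ltW o1).
case: (leP t 1) => [t1|/ltW t1].
  by rewrite (le_trans t1) // lerDr divr_ge0 // ltW.
rewrite -lerBlDr ler_pdivlMr //.
have /andP[+ _] := theta_tangent_le ler01 t1.
by have := theta_ge0 ler01; have := ler_norm c; lra.
Qed.

(** * Second differences of [theta] composed with the Euclidean norm *)

Section ThetaEnorm.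
Variable n : nat.
Implicit Types z v : 'rV[R]_n.
Local Notation nrm := (enorm (@dot R n)).

Lemma enorm_second_difference z v : nrm z != 0 ->
  nrm (z + v) + nrm (z - v) - 2 * nrm z <= nrm v ^+ 2 / nrm z.
Proof.
move=> z0; have z_gt0 : 0 < nrm z by rewrite lt_neqAle eq_sym z0 enorm_ge0.
have := parallelogram z v; have := enorm_ge0 v.
have := enorm_ge0 (z + v); have := enorm_ge0 (z - v).
move: (nrm (z + v)) (nrm (z - v)) (nrm z) (nrm v) z_gt0 {z0} => A B r q r0 B0 A0 q0.
rewrite ler_pdivlMr // => H.
(* The parallelogram law gives [(A + B)^2 <= 4 (r^2 + q^2)], and [4 r^2 (r^2 + q^2)] equals
   [(2 r^2 + q^2)^2 - q^4]. *)
have : (r * (A + B)) <= (2 * r ^+ 2 + q ^+ 2).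
  rewrite -(@ler_pXn2r _ 2) ?nnegrE ?mulr_ge0 ?addr_ge0 ?mulr_ge0 ?sqr_ge0 ?(ltW r0) //.
  have : (A + B) ^+ 2 <= 4 * (r ^+ 2 + q ^+ 2) by have := sqr_ge0 (A - B); lra.
  move=> /(ler_wpM2l (sqr_ge0 r)); rewrite exprMn => /le_trans; apply.
  by rewrite -subr_ge0; have := sqr_ge0 (q ^+ 2); rewrite !expr2; lra.
by rewrite !expr2; lra.
Qed.

(** With [A], [B], [r], [q] the norms of [z + v], [z - v], [z], [v], convexity of [theta] bounds the
    left side by [(A - r) omega A + (B - r) omega B]. Replacing [omega A] and [omega B] by [omega r]
    costs at most [q omega q] each, and [(A + B - 2 r) omega r] is at most [2 q omega q]; hence the
    constant 4. *)
Lemma theta_enorm_second_difference z v :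
  theta omega (nrm (z + v)) + theta omega (nrm (z - v)) - 2 * theta omega (nrm z)
  <= 4 * (nrm v * omega (nrm v)).
Proof.
have dA : `|nrm (z + v) - nrm z| <= nrm v.
  by rewrite (le_trans (ler_enormB _ _)) // addrC addKr.
have dB : `|nrm (z - v) - nrm z| <= nrm v.
  by rewrite (le_trans (ler_enormB _ _)) // [_ - _ - _]addrC addKr enormN.
move: (@enorm_second_difference z v) (enorm_ge0 z) (enorm_ge0 v) dA dB.
move: (enorm_ge0 (z + v)) (enorm_ge0 (z - v)).
move: (nrm (z + v)) (nrm (z - v)) (nrm z) (nrm v) => A B r q A0 B0 ABrq r0 q0 dA dB.
have prodle a : 0 <= a -> `|a - r| <= q ->
    (a - r) * (omega a - omega r) <= q * omega q.
  move=> a0 da; rewrite (le_trans (ler_norm _)) // normrM ler_pM //.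
  by rewrite (le_trans (modulusB a0 r0)) // modulus_homo.
have qr0 : 0 <= q * omega q by rewrite mulr_ge0 ?modulus_ge0.
suff AB2 : (A + B - 2 * r) * omega r <= 2 * (q * omega q).
  move: (prodle A A0 dA) (prodle B B0 dB) AB2 (thetaB_le r0 A0) (thetaB_le r0 B0).
  by lra.
have AB : A + B - 2 * r <= 2 * q.
  by move: (ler_norm (A - r)) (ler_norm (B - r)) dA dB; lra.
(* Near the origin the bound [A + B - 2 r <= 2 q] suffices; away from it the norm is smooth, and
   [(q^2 / r) omega r <= q omega q] because [omega t / t] is nonincreasing. *)
case: (leP r q) => [rq|qr].
  case: (leP 0 (A + B - 2 * r)) => [ab|/ltW ab].
    by rewrite mulrA ler_pM ?modulus_ge0 // modulus_homo.
  by apply: (@le_trans _ _ 0); [rewrite mulr_le0_ge0 ?modulus_ge0|rewrite mulr_ge0].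
have r_gt0 : 0 < r by exact: le_lt_trans qr.
move: (ABrq (lt0r_neq0 r_gt0)) => /(ler_wpM2r (modulus_ge0 r0)) /le_trans; apply.
have [->|qn0] := eqVneq q 0; first by rewrite expr0n !mul0r mulr0.
have q_gt0 : 0 < q by rewrite lt_neqAle eq_sym qn0.
rewrite mulrAC ler_pdivrMr // expr2 -!mulrA.
have := modulus_ratio q_gt0 (ltW qr).
move=> /(ler_wpM2l q0) /le_trans; apply.
by rewrite (mulrC r) ler_peMl ?ler1n ?mulr_ge0 ?modulus_ge0.
Qed.

End ThetaEnorm.
End Modulus.

(** * Differentials along lines and gradients *)

Section Lines.
Variables (R : realType) (V : normedModType R).
Implicit Types (F : V -> R) (x v : V).

Lemma is_derive_line F x v (s : R) : differentiable F (x + s *: v) ->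
  is_derive s 1 (fun t : R => F (x + t *: v)) ('d F (x + s *: v) v).
Proof.
move=> dF; have := derivableP (@diff_derivable _ _ _ F (x + s *: v) v dF).
rewrite deriveE // => -[dv dvE].
have E : (fun h : R => h^-1 *: (((fun t : R => F (x + t *: v)) \o shift s) (h *: 1)
            - F (x + s *: v))) =
    (fun h : R => h^-1 *: ((F \o shift (x + s *: v)) (h *: v) - F (x + s *: v))).
  apply/funext => h /=; rewrite [_%:A]mulr1 scalerDl addrCA.
by split; rewrite /derivable /derive E.
by split; rewrite /derivable /derive E.
Qed.

Lemma line_continuous F x v : (forall z, differentiable F z) ->
  continuous (fun t : R => F (x + t *: v)).
Proof.
move=> dF s; apply: differentiable_continuous; apply/derivable1_diffP.
by have [] := is_derive_line (dF (x + s *: v)).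
Qed.

Lemma mean_value F x v : (forall z, differentiable F z) ->
  exists2 s, 0 < s < 1 & F (x + v) - F x = 'd F (x + s *: v) v.
Proof.
move=> dF; have [s s01 E] := @MVT R (fun t : R => F (x + t *: v))
  (fun t => 'd F (x + t *: v) v) 0 1 ltr01
  (fun t _ => is_derive_line (dF (x + t *: v)))
  (continuous_subspaceT (line_continuous dF)).
exists s; first by move: s01; rewrite in_itv.
by move: E; rewrite scale1r scale0r addr0 subr0 mulr1.
Qed.

(** The mean value theorem is applied once, to [F (x + t v) + F (x - t v)], so that both
    differentials are taken at the same [s] and can be compared through the oscillation of the
    gradient. *)
Lemma second_difference_mean_value F x v : (forall z, differentiable F z) ->
  exists2 s, 0 < s < 1 & F (x + v) + F (x - v) - 2 * F x =
    'd F (x + s *: v) v - 'd F (x - s *: v) v.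
Proof.
move=> dF.
have dG (t : R) : is_derive t 1 (fun t : R => F (x + t *: v) + F (x + t *: - v))
    ('d F (x + t *: v) v + 'd F (x + t *: - v) (- v)).
  exact: (is_deriveD (is_derive_line (dF _)) (is_derive_line (dF _))).
have cG : continuous (fun t : R => F (x + t *: v) + F (x + t *: - v)).
  by move=> t; apply: cvgD; exact: line_continuous.
have [s s01 E] := @MVT R _ _ 0 1 ltr01 (fun t _ => dG t) (continuous_subspaceT cG).
exists s; first by move: s01; rewrite in_itv.
by move: E; rewrite !scale1r !scale0r addr0 subr0 mulr1 linearN scalerN => <-; ring.
Qed.

Lemma right_quotient_cvg F x v : differentiable F x ->
  h^-1 * (F (x + h *: v) - F x) @[h --> 0^'+] --> 'd F x v.
Proof.
move=> dF; have dv : derivable F x v by exact: diff_derivable.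
rewrite -deriveE //.
apply: (@cvg_dnbhs_at_right _ _ (fun h : R => h^-1 * (F (x + h *: v) - F x))).
have -> : (fun h : R => h^-1 * (F (x + h *: v) - F x)) =
    (fun h => h^-1 *: ((F \o shift x) (h *: v) - F x)).
  by apply/funext => h /=; rewrite (addrC x).
exact: dv.
Qed.

Lemma linear_norm_bounded_continuous (W : normedModType R) (f : {linear V -> W})
    (K : R) : 0 <= K -> (forall x, `|f x| <= K * `|x|) -> continuous f.
Proof.
move=> K0 fK; apply: bounded_linear_continuous; apply/ex_bound; exists K.
apply/nbhs_norm0P; exists 1 => //= x /= /ltW x1.
by rewrite (le_trans (fK x)) // ler_piMr.
Qed.

End Lines.

Section Gradient.
Variables (R : realType) (n : nat).
Implicit Types (F : 'rV[R]_n -> R) (x v : 'rV[R]_n).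
Local Notation nrm := (enorm (@dot R n)).
Local Notation grad := (gradient (@dot R n)).

Definition dot_lin (p v : 'rV[R]_n) : R^o := dot p v.

Lemma dot_lin_is_linear p : linear (dot_lin p).
Proof. by move=> a u v; rewrite /dot_lin dotDr dotZr. Qed.

HB.instance Definition _ p :=
  GRing.isLinear.Build R 'rV[R]_n R^o _ (dot_lin p) (dot_lin_is_linear p).

Lemma gradient_unique F x p : 'd F x =1 dot p -> grad F x = p.
Proof.
move=> dE; apply/eqP; rewrite -subr_eq0; apply/eqP/dot_eq0.
by rewrite dotBl -rV_gradientP dE subrr.
Qed.

Lemma dot_lin_continuous p : continuous (dot_lin p).
Proof.
apply: (@linear_norm_bounded_continuous _ _ _ _ (nrm p * n%:R)) => [|x].
  by rewrite mulr_ge0 ?enorm_ge0.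
rewrite -mulrA (le_trans (normr_dot_le _ _)) // ler_wpM2l ?enorm_ge0 //.
exact: enorm_le_norm.
Qed.

Lemma differentiable_of_remainder F x p :
    (forall e, 0 < e -> exists2 d, 0 < d &
       forall h, nrm h < d -> `|F (x + h) - F x - dot p h| <= e * nrm h) ->
  differentiable F x /\ grad F x = p.
Proof.
move=> rem.
have dF : (F : _ -> R^o) \o shift x =
    (cst (F x) : _ -> R^o) + dot_lin p +o_ (0 : 'rV[R]_n) id.
  apply/eqaddoP => e e0.
  (* [n.+1] instead of [n] keeps the comparison constant between the two norms positive when
     [n = 0]. *)
  have n0 : 0 < n.+1%:R :> R by rewrite ltr0n.
  have [d d0 Hd] := rem (e / n.+1%:R) (divr_gt0 e0 n0).
  have hn h : nrm h <= n.+1%:R * `|h|.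
    by rewrite (le_trans (enorm_le_norm h)) // ler_wpM2r // ler_nat.
  apply/(@nbhs_norm0P R 'rV[R]_n); exists (d / n.+1%:R) => /=; first exact: divr_gt0.
  move=> h /= hd; rewrite -[(_ - _) h]/(F (h + x) - (F x + dot p h)).
  rewrite opprD addrA addrC (addrC h) addrC (le_trans (Hd h _)) //.
    by rewrite (le_lt_trans (hn h)) // mulrC -ltr_pdivlMr.
  rewrite mulrAC ler_pdivrMr // -mulrA ler_wpM2l ?(ltW e0) //.
  by rewrite (mulrC `|_|) hn.
have dE := diff_unique (@dot_lin_continuous p) dF.
split; last by apply: gradient_unique => h; rewrite dE.
by apply/diff_locallyP; rewrite dE; split => //; exact: dot_lin_continuous.
Qed.

(** Difference quotients from the right give [<u, v> <= <grad F x, v>] for every [v]; the choice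
    [v = u - grad F x] forces equality. *)
Lemma subdifferential_gradient F x u : differentiable F x ->
  subdifferential F x u -> u = grad F x.
Proof.
move=> dF uF; apply/eqP; rewrite -subr_eq0; apply/eqP/dot_eq0.
have le_d v : dot u v <= dot (grad F x) v.
  rewrite -rV_gradientP; apply: (cvgr_to_ge (right_quotient_cvg dF)).
  near=> h; have h0 : 0 < h by near: h; exact: nbhs_right_gt.
  rewrite ler_pdivlMl // -dotZr lerBrDl.
  by have := uF (x + h *: v); rewrite [_ + _ - x]addrAC subrr add0r.
apply/le_anti; rewrite dot_ge0 andbT dotBl.
by have := le_d (u - grad F x); lra.
Unshelve. all: by end_near. Qed.

Lemma convex_gradient_le F x z : convex_fun F -> differentiable F x ->
  F x + dot (grad F x) (z - x) <= F z.
Proof.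
move=> /convex_functionP cF dF; rewrite -rV_gradientP -lerBrDl.
apply: (cvgr_to_le (right_quotient_cvg dF)).
near=> h; have h0 : 0 < h by near: h; exact: nbhs_right_gt.
have h1 : h <= 1 by near: h; exact: nbhs_right_le.
rewrite ler_pdivrMl //.
have := cF h z x (ltW h0) h1 I I.
have -> : h *: z + (1 - h) *: x = x + h *: (z - x).
  by rewrite scalerBl scale1r scalerBr addrCA.
by lra.
Unshelve. all: by end_near. Qed.

Section Restriction.
Variable X : {vspace 'rV[R]_n}.

Lemma vsval_continuous : continuous (vsval : subvs_of X -> 'rV[R]_n).
Proof.
apply: (@linear_norm_bounded_continuous _ (subvs_of X) 'rV[R]_n vsval 1) => // u.
by rewrite mul1r.
Qed.

(** The chain rule for the inclusion of [X] projects the gradient. [G] has the shape of the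
    remainders [phi_y], with all constants gathered in [c]. *)
Lemma restriction_gradient F p c (u : subvs_of X) :
  (forall x, differentiable F x) ->
  let G := fun w : subvs_of X => F (vsval w) - c - dot p (vsval w) in
  differentiable G u /\
  gradient (@sdot R n X) G u = orthproj X (grad F (vsval u) - p).
Proof.
move=> dF G.
have dvs : differentiable (vsval : subvs_of X -> 'rV[R]_n) u.
  exact: linear_differentiable vsval_continuous.
have dlp : differentiable (dot_lin p) (vsval u).
  exact: linear_differentiable (@dot_lin_continuous p).
have dF1 : differentiable (F \o vsval) u by exact: differentiable_comp.
have dl1 : differentiable (dot_lin p \o vsval) u by exact: differentiable_comp.
have GE : G = (F \o vsval) - cst c - (dot_lin p \o vsval) by [].
have dFc : differentiable ((F \o vsval) - cst c) u by exact: differentiableB.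
have E1 : 'd (F \o vsval) u = 'd F (vsval u) \o 'd vsval u :> (_ -> _).
  exact: (diff_comp dvs (dF _)).
have E2 : 'd (dot_lin p \o vsval) u = 'd (dot_lin p) (vsval u) \o 'd vsval u :> (_ -> _).
  exact: (diff_comp dvs dlp).
have E3 := diff_lin u vsval_continuous.
have E4 := diff_lin (vsval u) (@dot_lin_continuous p).
have E5 := diffB dFc dl1.
have E6 := diffB dF1 (differentiable_cst c u).
have dGE : differentiable G u by rewrite GE; exact: differentiableB.
split => //.
apply: sub_riesz_unique => v; rewrite -sub_gradientP sdot_orthproj.
have F1 := congr1 (fun k => k v) E1; have F2 := congr1 (fun k => k v) E2.
have F3 := congr1 (fun k => k v) E3; have F4 := congr1 (fun k => k (vsval v)) E4.
have F5 := congr1 (fun k => k v) E5; have F6 := congr1 (fun k => k v) E6.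
have F7 := congr1 (fun k => k v) (diff_cst (c : R^o) u).
rewrite -GE in F5; move: F1 F2 F3 F4 F5 F6 F7 => /= F1 F2 F3 F4 F5 F6 F7.
rewrite dotBl -rV_gradientP; apply: (etrans F5); congr (_ - _).
  apply: (etrans F6); apply: (etrans (congr2 _ F1 (congr1 _ F7))).
  by apply: (etrans (subr0 _)); apply: congr1.
by apply: (etrans F2); apply: (etrans (congr1 _ F3)).
Qed.

End Restriction.
End Gradient.

(** * Convex functions with controlled second differences *)

Section SmoothConvex.
Variables (R : realType) (n : nat).
Implicit Types (F G : 'rV[R]_n -> R) (x v p : 'rV[R]_n).
Local Notation nrm := (enorm (@dot R n)).
Local Notation grad := (gradient (@dot R n)).

(** The origin is the average of [v] and [- t v] with weights [t / (1 + t)] and [1 / (1 + t)]. *)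
Lemma convex_opposite_ge0 G t v : convex_fun G -> G 0 = 0 -> 0 < t ->
  0 <= t * G v + G (- (t *: v)).
Proof.
move=> /convex_functionP cG G0 t0; have t1 : 0 < 1 + t by rewrite addr_gt0.
have := cG (t / (1 + t)) v (- (t *: v)).
rewrite divr_ge0 ?(ltW t0) ?(ltW t1) // ler_pdivrMr // mul1r lerDr ler01.
have -> : 1 - t / (1 + t) = (1 + t)^-1.
  by field; rewrite gt_eqF.
rewrite scalerN scalerA (mulrC _ t) subrr G0 => /(_ isT isT I I).
rewrite -(ler_pM2l t1) mulr0 mulrDr !mulrA (mulrC _ t) mulfK ?gt_eqF //.
by rewrite divff ?gt_eqF // mul1r.
Qed.

(* The convex function [G - p] is nonnegative on the coordinate axes when
   [p] is assembled from one-dimensional subgradients; smoothness at [0] then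
   makes it [o(t)] along every ray, and convexity makes it nonnegative. *)
Lemma smooth_convex_support G : convex_fun G -> G 0 = 0 ->
    (forall v e, 0 < e -> exists2 d, 0 < d &
       forall t, 0 < t -> t < d -> G (t *: v) + G (- (t *: v)) <= e * t) ->
  exists p, forall v, dot p v <= G v.
Proof.
move=> cG G0 smooth; have cGP := (convex_functionP _ _).1 cG.
pose q i t := G (t *: delta_mx 0 i) / t.
pose S i := [set q i t | t in [set t | 0 < t]].
(* Quotients along one axis direction are bounded below by those along the opposite one, so
   [inf (S i)], the right derivative at 0, is a true infimum. *)
have S_lb i s : 0 < s -> lbound (S i) (- (G (- (s *: delta_mx 0 i)) / s)).
  move=> s0 _ [t t0 <-]; rewrite /q -mulNr ler_pdivrMr // mulrAC ler_pdivlMr //.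
  have := @convex_opposite_ge0 G (s / t) (t *: delta_mx 0 i) cG G0 (divr_gt0 s0 t0).
  rewrite scalerA divfK ?gt_eqF // -(ler_pM2l t0) mulr0 mulrDr mulrA.
  by rewrite (mulrC t) divfK ?gt_eqF //; lra.
pose p : 'rV[R]_n := \row_i inf (S i).
have axis i t : t * p 0 i <= G (t *: delta_mx 0 i).
  have [t0|t0|->] := ltrgtP t 0; last by rewrite mul0r scale0r G0.
    have t0' : 0 < - t by rewrite oppr_gt0.
    have : - (G (- (- t *: delta_mx 0 i)) / - t) <= p 0 i.
      rewrite mxE; apply: lb_le_inf; last exact: S_lb.
      by exists (q i 1); exists 1 => //=.
    rewrite scaleNr opprK invrN mulrN opprK ler_ndivrMr // mulrC //.
  rewrite -ler_pdivlMl // mulrC mxE; apply: ge_inf; last by exists t.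
  exists (- (G (- (1 *: delta_mx 0 i)) / 1)); exact: S_lb.
pose h v := G v - dot p v.
have h0 : h 0 = 0 by rewrite /h G0 dot0r subr0.
have chP s u v : 0 <= s -> s <= 1 ->
    h (s *: u + (1 - s) *: v) <= s * h u + (1 - s) * h v.
  by move=> s0 s1; have := cGP s u v s0 s1 I I; rewrite /h dotDr !dotZr; lra.
have ch : convex_fun h by apply/convex_functionP => s u v s0 s1 _ _; exact: chP.
pose small v := forall e, 0 < e -> exists2 d, 0 < d &
  forall t, 0 < t -> t < d -> h (t *: v) <= e * t.
have small0 : small 0.
  by move=> e e0; exists 1 => // t t0 _; rewrite scaler0 h0 mulr_ge0 ?ltW.
(* An upper bound of this kind passes to sums by convexity at a midpoint, which is why the scale
   doubles. *)
have smallD u v : small u -> small v -> small (u + v).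
  move=> su sv e e0; have e20 : 0 < e / 2 by rewrite divr_gt0.
  have [d1 d10 H1] := su _ e20; have [d2 d20 H2] := sv _ e20.
  exists (Num.min d1 d2 / 2); first by rewrite divr_gt0 // lt_min d10.
  move=> t t0; rewrite ltr_pdivlMr // lt_min => /andP[t1 t2].
  have tt0 : 0 < t * 2 by rewrite mulr_gt0.
  have := H1 _ tt0 t1; have := H2 _ tt0 t2.
  have := @chP (1 / 2) ((t * 2) *: u) ((t * 2) *: v).
  have -> : (1 / 2) *: ((t * 2) *: u) + (1 - 1 / 2) *: ((t * 2) *: v) = t *: (u + v).
    by rewrite !scalerA scalerDr; congr (_ *: _ + _ *: _); field.
  by move=> /(_ ltac:(lra) ltac:(lra)); lra.
have small_all v : small v.
  rewrite (row_sum_delta v); apply: (big_ind small) => // i _ e e0.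
  (* [h] is nonnegative on the opposite half-axis, so the smoothness bound on the sum bounds the
     value on this one. *)
  have [d d0 H] := smooth (v 0 i *: delta_mx 0 i) e e0.
  exists d => // t t0 td; have := H t t0 td.
  have := axis i (- (t * v 0 i)); rewrite /h scaleNr scalerA.
  by rewrite dotC dotZ dotC -row_dot_delta; lra.
exists p => v; rewrite -subr_ge0 -/(h v); apply/ler_addgt0Pr => e e0.
(* The upper bound along [- v] becomes, through the opposite-point inequality, [h v >= - e]. *)
have [d d0 H] := small_all (- v) e e0.
have d20 : 0 < d / 2 by rewrite divr_gt0.
have := H (d / 2) d20; rewrite ltr_pdivrMr // ltr_pMr // ltr1n => /(_ isT).
have := @convex_opposite_ge0 h (d / 2) v ch h0 d20; rewrite scalerN.
by move=> A B; rewrite -(ler_pM2l d20) mulr0; lra.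
Qed.

Variable omega : R -> R.
Hypothesis omega_modulus : modulus_of_continuity omega.

Lemma modulus_small e : 0 < e ->
  exists2 d, 0 < d & forall t, 0 <= t -> t < d -> omega t <= e.
Proof.
move=> e0; case: omega_modulus => om0 _ _ /continuous_within_itvcyP[_].
rewrite om0 => /cvgrPdist_le /(_ e e0).
move=> om_near; near (0 : R)^'+ => d.
have d0 : 0 < d by near: d; exact: nbhs_right_gt.
have omd : `|0 - omega d| <= e by near: d; exact: om_near.
exists d => // t t0 td; rewrite (le_trans (modulus_homo omega_modulus t0 (ltW td))) //.
by move: omd; rewrite sub0r normrN; exact: le_trans (ler_norm _).
Unshelve. all: by end_near. Qed.

Section AtPoint.
Variables (F : 'rV[R]_n -> R) (x : 'rV[R]_n) (r C : R).
Hypotheses (cF : convex_fun F) (r_gt0 : 0 < r) (C_ge0 : 0 <= C).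
Hypothesis F2 : forall v, nrm v <= r ->
  F (x + v) + F (x - v) - 2 * F x <= C * (nrm v * omega (nrm v)).

Lemma second_difference_subgradient :
  exists p, forall v, dot p v <= F (x + v) - F x.
Proof.
apply: (@smooth_convex_support (fun v => F (x + v) - F x)).
- apply/convex_functionP => s u v s0 s1 _ _.
  have := (convex_functionP _ _).1 cF s (x + u) (x + v) s0 s1 I I.
  have -> : s *: (x + u) + (1 - s) *: (x + v) = x + (s *: u + (1 - s) *: v).
    by rewrite !scalerDr addrACA -scalerDl subrKC scale1r.
  by lra.
- by rewrite addr0 subrr.
move=> v e e0; set k := C * nrm v + 1; set m := nrm v + 1.
have v0 := enorm_ge0 v.
have k0 : 0 < k by rewrite /k ltr_wpDl ?mulr_ge0.
have m0 : 0 < m by rewrite /m ltr_wpDl.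
have [d d0 Hd] := modulus_small (divr_gt0 e0 k0).
exists (Num.min d r / m); first by rewrite divr_gt0 // lt_min d0.
move=> t t0; rewrite ltr_pdivlMr // lt_min => /andP[td tr].
have nt : nrm (t *: v) = t * nrm v by rewrite enormZ gtr0_norm.
have ntm : nrm (t *: v) <= t * m by rewrite nt ler_pM2l // /m lerDl.
have := F2 (le_trans ntm (ltW tr)).
have omd := Hd _ (enorm_ge0 _) (le_lt_trans ntm td).
rewrite ler_pdivlMr // in omd.
suff : C * (nrm (t *: v) * omega (nrm (t *: v))) <= e * t by lra.
rewrite {1}nt; move: (omega _) omd (modulus_ge0 omega_modulus (enorm_ge0 (t *: v))).
move=> W omd W0.
have -> : C * (t * nrm v * W) = t * (C * nrm v * W) by ring.
rewrite [e * t]mulrC ler_pM2l //.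
rewrite (le_trans _ omd) // mulrC ler_wpM2l //.
by rewrite /k lerDl.
Qed.

(** A subgradient [p] at [x] gives [F (x - v) >= F x - <p, v>]; inserted in the second difference,
    this yields a two-sided first-order estimate whose remainder is [o(|v|)]. *)
Lemma second_difference_differentiable : differentiable F x /\
  forall v, nrm v <= r ->
    0 <= F (x + v) - F x - dot (grad F x) v <= C * (nrm v * omega (nrm v)).
Proof.
have [p pP] := second_difference_subgradient.
have bnd v : nrm v <= r ->
    0 <= F (x + v) - F x - dot p v <= C * (nrm v * omega (nrm v)).
  move=> vr; rewrite subr_ge0 pP /= (le_trans _ (F2 vr)) //.
  by have := pP (- v); rewrite dotNr; lra.
have [|dF ->] := @differentiable_of_remainder R n F x p; last by split.
move=> e e0; have C1 : 0 < C + 1 by rewrite ltr_wpDl.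
have [d d0 Hd] := modulus_small (divr_gt0 e0 C1).
exists (Num.min d r); first by rewrite lt_min d0.
move=> v; rewrite lt_min => /andP[vd vr].
have /andP[v0 vC] := bnd v (ltW vr).
rewrite ger0_norm // (le_trans vC) // mulrCA mulrC ler_wpM2r ?enorm_ge0 //.
have := Hd _ (enorm_ge0 v) vd; rewrite ler_pdivlMr // => /(le_trans _); apply.
by rewrite mulrC ler_wpM2l ?(modulus_ge0 omega_modulus) ?enorm_ge0 // lerDl.
Qed.

End AtPoint.

Hypothesis omega_concave : concave_modulus omega.

(** With [D = grad F y - grad F x] and [q = |y - x|], the value of [F] at [y + w] is bounded below
    from [y] and above from [x]. Taking [w] of length [q] along [D] gives
    [q |D| <= C (2 q) (2 omega q)], whence the constant [4 C]. *)
Lemma second_difference_C1omega_loc F : convex_fun F ->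
    (forall r, 0 < r -> exists2 C, 0 <= C & forall x v, nrm x <= r -> nrm v <= r ->
       F (x + v) + F (x - v) - 2 * F x <= C * (nrm v * omega (nrm v))) ->
  C1omega_loc (@dot R n) omega F.
Proof.
have arith (a b d e f g k : R) : 0 <= b - a - d -> e - a - (d + f) <= g ->
  0 <= e - b - k -> k - f <= g by lra.
move=> cF F2; split=> [x|c r].
  have r0 : 0 < nrm x + 1 by rewrite ltr_wpDl ?enorm_ge0.
  have [C C0 HC] := F2 _ r0.
  have [] // := @second_difference_differentiable F x (nrm x + 1) C cF r0 C0.
  by move=> v; apply: HC; rewrite lerDl.
set B := nrm c + `|r| + 1.
have B0 : 0 < B by rewrite ltr_wpDl // addr_ge0 ?enorm_ge0.
(* Room for all increments: [|y - x| <= 2 B] and [|y - x + w| <= 2 |y - x| <= 4 B]. *)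
have r40 : 0 < 4 * B by rewrite mulr_gt0.
have [C C0 HC] := F2 _ r40; exists (4 * C) => x y xr yr.
have ballB z : nrm (z - c) <= r -> nrm z <= B.
  move=> zr; rewrite -(subrK c z) (le_trans (enormD _ _)) // /B addrC -addrA.
  by rewrite lerD2l (le_trans zr) // (le_trans (ler_norm r)) // lerDl.
have xB := ballB x xr; have yB := ballB y yr.
have est z : nrm z <= B -> differentiable F z /\
    forall v, nrm v <= 4 * B ->
      0 <= F (z + v) - F z - dot (grad F z) v <= C * (nrm v * omega (nrm v)).
  move=> zB; apply: second_difference_differentiable => // v vB; apply: HC => //.
  by rewrite (le_trans zB) // ler_peMl ?(ltW B0) // ler1n.
have [_ ex] := est x xB; have [_ ey] := est y yB.
rewrite enormB (enormB x y).
have : y = x -> grad F y - grad F x = 0 by move=> ->; rewrite subrr.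
move: (grad F x) (grad F y) ex ey => gx gy ex ey yx_eq0.
set D := gy - gx; set q := nrm (y - x).
have [D0|D0] := eqVneq D 0.
  rewrite D0 enorm0 mulr_ge0 ?mulr_ge0 ?(modulus_ge0 omega_modulus) ?enorm_ge0 //.
have q_ge0 : 0 <= q by exact: enorm_ge0.
have q2B : q <= 2 * B.
  by rewrite (le_trans (enormD _ _)) // enormN; lra.
have q_gt0 : 0 < q.
  apply: enorm_gt0; apply: contra_neq D0 => /eqP; rewrite subr_eq0 => /eqP yx.
  exact: yx_eq0.
have nD := enorm_gt0 D0.
have [w wq Dw] : exists2 w, nrm w = q & dot D w = q * nrm D.
  exists ((q / nrm D) *: D).
    by rewrite enormZ ger0_norm ?divr_ge0 ?ltW // divfK ?gt_eqF.
  by rewrite dotZr -enorm_sqr expr2 mulrA divfK ?gt_eqF.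
have sq : nrm (y - x + w) <= 2 * q.
  by rewrite (le_trans (enormD _ _)) // wq -/q; lra.
have /andP[+ _] := ey w ltac:(rewrite wq; lra).
have /andP[_ +] := ex (y - x + w) ltac:(lra).
have /andP[+ _] := ex (y - x) ltac:(rewrite -/q; lra).
have -> : x + (y - x + w) = y + w by rewrite addrA addrCA subrr addr0.
have -> : x + (y - x) = y by rewrite addrCA subrr addr0.
move=> H1 H2 H3; rewrite dotDr in H2.
have H4 : q * nrm D <= C * (nrm (y - x + w) * omega (nrm (y - x + w))).
  by rewrite -Dw /D dotBl; exact: arith H1 H2 H3.
have H5 : nrm (y - x + w) * omega (nrm (y - x + w)) <= (2 * q) * (2 * omega q).
  apply: ler_pM => //; rewrite ?enorm_ge0 ?(modulus_ge0 omega_modulus) ?enorm_ge0 //.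
  rewrite (le_trans (modulus_homo omega_modulus (enorm_ge0 _) sq)) //.
  exact: modulus_double.
rewrite -(ler_pM2l q_gt0) (le_trans H4) // (le_trans (ler_wpM2l C0 H5)) //.
by rewrite le_eqVlt; apply/orP; left; apply/eqP; ring.
Qed.

End SmoothConvex.

(** * Convex envelopes *)

Section ConvexEnvelope.
Variables (R : realType) (n : nat).
Implicit Types (F g phi : 'rV[R]_n -> R) (x v : 'rV[R]_n).

(** Arbitrary finite index types let two combinations be joined on a sum type, without any bound on
    the number of points. *)
Definition convex_combination (T : finType) (l : T -> R) (z : T -> 'rV[R]_n) x :=
  [/\ forall i, 0 <= l i, \sum_i l i = 1 & \sum_i l i *: z i = x].

(** Jensen's inequality before normalization, so that the induction also passes through partial
    weights [S = 0], where [S^-1] is 0 and the left side vanishes. *)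
Lemma convex_weighted_sum F (T : finType) (l : T -> R) (z : T -> 'rV[R]_n)
    (s : seq T) : convex_fun F -> (forall i, 0 <= l i) ->
  let S := \sum_(i <- s) l i in
  S * F (S^-1 *: \sum_(i <- s) l i *: z i) <= \sum_(i <- s) l i * F (z i).
Proof.
move=> /convex_functionP cF l0; elim: s => [|a s IHs] /=.
  by rewrite !big_nil mul0r.
rewrite !big_cons; set S := \sum_(i <- s) l i in IHs *.
have S0 : 0 <= S by exact: sumr_ge0.
have [la0|lan0] := eqVneq (l a) 0; first by rewrite la0 scale0r mul0r !add0r.
have la_gt0 : 0 < l a by rewrite lt_neqAle eq_sym lan0 l0.
have T0 : 0 < l a + S by rewrite ltr_pwDl.
have [SE|Sn0] := eqVneq S 0.
  have l_s i : i \in s -> l i = 0.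
    move=> si; move/eqP: SE; rewrite psumr_eq0 // => /allP/(_ i si) /=.
    by move=> /eqP.
  rewrite !big_seq !big1 => [|i /l_s ->|i /l_s ->]; rewrite ?mul0r ?scale0r //.
  by rewrite SE !addr0 scalerA mulVf // scale1r.
have S_gt0 : 0 < S by rewrite lt_neqAle eq_sym Sn0.
set Z := \sum_(i <- s) l i *: z i in IHs *.
have := cF (l a / (l a + S)) (z a) (S^-1 *: Z).
rewrite divr_ge0 ?(ltW T0) // ler_pdivrMr // mul1r lerDl S0.
move=> /(_ isT isT I I).
have -> : 1 - l a / (l a + S) = S / (l a + S) by field; rewrite gt_eqF.
rewrite scalerA mulrAC divff // mul1r [in X in F X](mulrC (l a)) -scalerA -scalerDr.
rewrite -(ler_pM2l T0) => /le_trans; apply.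
rewrite [leLHS](_ : _ = l a * F (z a) + S * F (S^-1 *: Z)).
  by rewrite lerD2l.
by field; rewrite gt_eqF.
Qed.

Lemma convex_jensen F (T : finType) (l : T -> R) (z : T -> 'rV[R]_n) x :
  convex_fun F -> convex_combination l z x -> F x <= \sum_i l i * F (z i).
Proof.
move=> cF [l0 l1 lx]; have := @convex_weighted_sum F T l z (index_enum T) cF l0.
by rewrite /= l1 lx invr1 scale1r mul1r.
Qed.

Lemma combination_dot (T : finType) (l : T -> R) (z : T -> 'rV[R]_n) x u :
  convex_combination l z x -> \sum_i l i * dot u (z i) = dot u x.
Proof.
by case=> _ _ <-; rewrite dot_sumr; apply: eq_bigr => i _; rewrite dotZr.
Qed.

Variables g phi0 : 'rV[R]_n -> R.
Hypotheses (cphi0 : convex_fun phi0) (phi0_le : forall x, phi0 x <= g x).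
Local Notation F := (convex_envelope g).

Let minorants x := [set phi x | phi in
  [set phi | convex_fun phi /\ forall z, phi z <= g z]].

Lemma minorants_neq0 x : minorants x !=set0.
Proof. by exists (phi0 x); exists phi0. Qed.

Lemma minorants_ub x : has_ubound (minorants x).
Proof. by exists (g x) => _ [phi [_ phig] <-]. Qed.

Lemma envelope_ge phi x : convex_fun phi -> (forall z, phi z <= g z) -> phi x <= F x.
Proof. by move=> cphi phig; apply: ub_le_sup; [exact: minorants_ub|exists phi]. Qed.

Lemma envelope_le x : F x <= g x.
Proof. by apply: ge_sup => [|_ [phi [_ phig] <-]//]; exact: minorants_neq0. Qed.

Lemma envelope_convex : convex_fun F.
Proof.
apply/convex_functionP => s x y s0 s1 _ _; apply: ge_sup; first exact: minorants_neq0.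
move=> _ [phi [cphi phig] <-].
have /convex_functionP/(_ s x y s0 s1 I I) := cphi => /le_trans; apply.
by rewrite lerD // ler_wpM2l ?subr_ge0 // envelope_ge.
Qed.

Lemma envelope_le_combination (T : finType) (l : T -> R) z x :
  convex_combination l z x -> F x <= \sum_i l i * g (z i).
Proof.
move=> lzx; have [l0 _ _] := lzx.
rewrite (le_trans (convex_jensen envelope_convex lzx)) //.
by apply: ler_sum => i _; rewrite ler_wpM2l ?envelope_le.
Qed.

(** The envelope described from above, by averages of [g]. Since [hull] is convex and below [g], it
    is below [F]; so an average within [e] of [hull x] is at most [F x + e]. *)
Let combination_values x := [set r | exists (T : finType) (l : T -> R) z,
  convex_combination l z x /\ \sum_i l i * g (z i) = r].
Let hull x := inf (combination_values x).

Lemma combination_values_self x : combination_values x (g x).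
Proof.
exists unit, (fun=> 1), (fun=> x); rewrite big_const card_unit /= mul1r addr0.
by do ![split]; rewrite // big_const card_unit /= ?addr0 ?scale1r.
Qed.

Lemma combination_values_lb x : has_lbound (combination_values x).
Proof. by exists (F x) => _ [T [l [z [lzx <-]]]]; exact: envelope_le_combination. Qed.

Lemma hull_le x : hull x <= g x.
Proof.
apply: ge_inf; first exact: combination_values_lb.
exact: combination_values_self.
Qed.

Lemma hull_approx x e : 0 < e -> exists (T : finType) (l : T -> R) z,
  convex_combination l z x /\ \sum_i l i * g (z i) < hull x + e.
Proof.
move=> e0; have hi : has_inf (combination_values x).
  split; last exact: combination_values_lb.
  by exists (g x); exact: combination_values_self.
by have [_ [T [l [z [lzx <-]]]] lt] := inf_adherent e0 hi; exists T, l, z.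
Qed.

Lemma hull_convex : convex_fun hull.
Proof.
apply/convex_functionP => s x y s0 s1 _ _; apply/ler_addgt0Pr => e e0.
have [T1 [l1 [z1 [[l10 l11 lx] H1]]]] := hull_approx x e0.
have [T2 [l2 [z2 [[l20 l21 ly] H2]]]] := hull_approx y e0.
have s10 : 0 <= 1 - s by rewrite subr_ge0.
pose l (i : T1 + T2) := match i with inl i => s * l1 i | inr i => (1 - s) * l2 i end.
pose z (i : T1 + T2) := match i with inl i => z1 i | inr i => z2 i end.
have lzc : convex_combination l z (s *: x + (1 - s) *: y).
  split=> [[i|i]||]; rewrite ?mulr_ge0 // big_sumType /=.
    by rewrite -!mulr_sumr l11 l21 !mulr1 subrKC.
  rewrite -lx -ly !scaler_sumr; congr (_ + _);
    by apply: eq_bigr => i _; rewrite scalerA.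
apply: (@le_trans _ _ (\sum_i l i * g (z i))).
  by apply: ge_inf; [exact: combination_values_lb|exists (T1 + T2)%type, l, z].
rewrite big_sumType /=.
under eq_bigr do rewrite -mulrA.
under [X in _ + X <= _]eq_bigr do rewrite -mulrA.
rewrite -!mulr_sumr.
have := ler_wpM2l s0 (ltW H1); have := ler_wpM2l s10 (ltW H2); lra.
Qed.

Lemma envelope_approx x e : 0 < e -> exists (T : finType) (l : T -> R) z,
  convex_combination l z x /\ \sum_i l i * g (z i) <= F x + e.
Proof.
move=> e0; have [T [l [z [lzx lt]]]] := hull_approx x e0.
exists T, l, z; split=> //; rewrite (le_trans (ltW lt)) // lerD2r.
exact: envelope_ge hull_convex hull_le.
Qed.

Lemma envelope_le_shift (T : finType) (l : T -> R) z (d : T -> 'rV[R]_n) x v :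
  convex_combination l z x -> \sum_i l i *: d i = v ->
  F (x + v) <= \sum_i l i * g (z i + d i).
Proof.
move=> [l0 l1 lx] dv; apply: envelope_le_combination; split => //.
by under eq_bigr do rewrite scalerDr; rewrite big_split /= lx dv.
Qed.

(* A near-optimal combination may involve points far away, where [g] is not
   controlled; but at least half of its mass sits where [N <= 2 * K], and only
   these points are moved. *)
Lemma envelope_second_difference (N : 'rV[R]_n -> R) x v K C :
    (forall w, 0 <= N w) -> 0 < K -> 0 <= C ->
    (forall (T : finType) (l : T -> R) z, convex_combination l z x ->
       \sum_i l i * g (z i) <= F x + 1 -> \sum_i l i * N (z i) <= K) ->
    (forall w s, N w <= 2 * K -> 1 <= s -> s <= 2 ->
       g (w + s *: v) + g (w - s *: v) - 2 * g w <= C) ->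
  F (x + v) + F (x - v) - 2 * F x <= C.
Proof.
move=> N0 K0 C0 mass g2; apply/ler_addgt0Pr => e e0.
(* An error of at most 1 makes [mass] applicable; [e / 2] because the average enters the second
   difference twice. *)
have e1 : 0 < Num.min 1 (e / 2) by rewrite lt_min ltr01 divr_gt0.
have [T [l [z [lzx val]]]] := envelope_approx x e1.
have [l0 l1 lx] := lzx.
have val1 : \sum_i l i * g (z i) <= F x + 1.
  by rewrite (le_trans val) // lerD2l ge_min lexx.
have vale : \sum_i l i * g (z i) <= F x + e / 2.
  by rewrite (le_trans val) // lerD2l ge_min lexx orbT.
pose near i := N (z i) <= 2 * K.
pose L := \sum_(i | near i) l i.
have L1 : L <= 1.
  by rewrite -l1 [leRHS](bigID near) /= lerDl sumr_ge0.
(* Markov's inequality: the mass beyond [2 K] is at most 1/2. *)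
have L2 : 1 / 2 <= L.
  have : 2 * K * (1 - L) <= K.
    apply: le_trans (mass T l z lzx val1).
    have -> : 1 - L = \sum_(i | ~~ near i) l i.
      by rewrite -l1 (bigID near) /= -/L addrAC subrr add0r.
    rewrite mulr_sumr.
    rewrite [leRHS](bigID near) /= ler_wpDl //.
      by apply: sumr_ge0 => i _; rewrite mulr_ge0.
    apply: ler_sum => i; rewrite -ltNge => /ltW iK.
    by rewrite mulrC ler_wpM2l.
  by move=> KL; rewrite -(ler_pM2l K0); lra.
have L0 : 0 < L by rewrite (lt_le_trans _ L2) // divr_gt0.
(* Mass [L] displaced by [L^-1 v] moves the average by [v]; the bounds [1 <= L^-1 <= 2] are the
   range of [s] in the hypothesis on [g]. *)
pose d i := if near i then L^-1 *: v else 0.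
have dv : \sum_i l i *: d i = v.
  rewrite (bigID near) /= [X in _ + X]big1 ?addr0 => [|i /negPf]; last first.
    by rewrite /d => ->; rewrite scaler0.
  under eq_bigr => i ni do rewrite /d ni.
  by rewrite -scaler_suml scalerA divff ?gt_eqF // scale1r.
have dNv : \sum_i l i *: - d i = - v.
  by under eq_bigr do rewrite scalerN; rewrite sumrN dv.
have H1 := envelope_le_shift lzx dv; have H2 := envelope_le_shift lzx dNv.
have H3 : \sum_i l i * g (z i + d i) + \sum_i l i * g (z i - d i)
    - 2 * \sum_i l i * g (z i) <= C.
  rewrite mulr_sumr -big_split -sumrB /=.
  rewrite -[leRHS]mul1r -[X in _ <= X * _]l1 mulr_suml; apply: ler_sum => i _.
  have -> : l i * g (z i + d i) + l i * g (z i - d i) - 2 * (l i * g (z i)) =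
    l i * (g (z i + d i) + g (z i - d i) - 2 * g (z i)) by ring.
  rewrite ler_wpM2l // /d; case: ifPn => [ni|_].
    apply: g2 => //; first by rewrite -invr1 lef_pV2 ?posrE.
    by rewrite -[leRHS]invrK lef_pV2 ?posrE ?invr_gt0 // -div1r.
  by rewrite subr0 addr0 (_ : _ - _ = 0) //; ring.
by move: H1 H2 H3 vale; lra.
Qed.

End ConvexEnvelope.

(** * Extension of a jet *)

(* Here [E], [t], [xi] are the [E^*], [t_y], [xi_y] of the theorem. *)
Section JetExtension.
Variables (R : realType) (n : nat) (omega : R -> R).
Hypothesis omega_modulus : modulus_of_continuity omega.
Hypothesis omega_concave : concave_modulus omega.
Hypothesis omega_strict : {in `[0, +oo[ &, {homo omega : s t / s < t}}.
Variables (X : {vspace 'rV[R]_n}) (E : set 'rV[R]_n).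
Variables (t : 'rV[R]_n -> R) (xi : 'rV[R]_n -> 'rV[R]_n).
Variables (phi : 'rV[R]_n -> subvs_of X -> R) (a : R).
Hypotheses (E_neq0 : E !=set0) (a_gt0 : 0 < a).
Hypothesis jet : jet_condition omega E t xi phi.

Local Notation nrm := (enorm (@dot R n)).
Local Notation snrm := (enorm (@sdot R n X)).
Local Notation sgrad := (gradient (@sdot R n X)).
Local Notation P := (orthproj X).
Implicit Types (x y z v w : 'rV[R]_n) (u : subvs_of X).

Let tangent y x := t y + dot (xi y) (x - y).
Let cost y x := tangent y x + phi y (P x) + a * theta omega (snrm (P (x - y))).
Let g x := inf [set cost y x | y in E].
Local Notation F := (convex_envelope g).

Lemma tangent_convex y : convex_fun (tangent y).
Proof.
apply/convex_functionP => s x z s0 s1 _ _; rewrite /tangent.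
by rewrite !dotBr dotDr !dotZr; lra.
Qed.

Lemma tangent_le_cost z y x : E z -> E y -> tangent z x <= cost y x.
Proof.
case: jet => _ _ _ dom Ez Ey; rewrite (le_trans (dom z y Ez Ey x)) // /cost lerDl.
by rewrite mulr_ge0 ?(ltW a_gt0) // theta_ge0 // senorm_ge0.
Qed.

Lemma costs_has_lbound x : has_lbound [set cost y x | y in E].
Proof.
have [z Ez] := E_neq0; exists (tangent z x) => _ [y Ey <-].
exact: tangent_le_cost.
Qed.

Lemma inf_cost_le y x : E y -> g x <= cost y x.
Proof. by move=> Ey; apply: ge_inf; [exact: costs_has_lbound|exists y]. Qed.

Lemma tangent_le_inf_cost z x : E z -> tangent z x <= g x.
Proof.
move=> Ez; apply: lb_le_inf => [|_ [y Ey <-]]; last exact: tangent_le_cost.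
by exists (cost z x); exists z.
Qed.

Lemma inf_cost_approx x e : 0 < e -> exists2 y, E y & cost y x < g x + e.
Proof.
move=> e0; have hi : has_inf [set cost y x | y in E].
  by split; [have [z Ez] := E_neq0; exists (cost z x); exists z|exact: costs_has_lbound].
by have [_ [y Ey <-] lt] := inf_adherent e0 hi; exists y.
Qed.

Lemma phi_gradient_holder r : 0 < r -> exists2 M, 0 <= M &
  forall y u1 u2, E y -> snrm (P y) <= r -> snrm u1 <= r -> snrm u2 <= r ->
    snrm (sgrad (phi y) u1 - sgrad (phi y) u2) <= M * omega (snrm (u1 - u2)).
Proof.
move=> r0; case: jet => _ _ /(_ r r0) + _.
set S := holder_ratios _ _ _ _ => supS.
have [M M0 HM] : exists2 M : R, 0 <= M & forall q, S q -> (q <= M%:E)%E.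
  case: (ereal_sup S) supS (@ereal_sup_ubound _ S) => [M| |] // _ ub.
    by exists (`|M|) => // q /ub /le_trans; apply; rewrite lee_fin ler_norm.
  (* A supremum [-oo] means that there are no ratios, so the constant 0 will do. *)
  exists 0 => // q /ub; rewrite leeNy_eq => /eqP ->; exact: leNye.
exists M => // y u1 u2 Ey yr r1 r2.
have [->|u12] := eqVneq u1 u2.
  by rewrite !subrr senorm0 (modulus0 omega_modulus) mulr0.
have n12 : 0 < snrm (u1 - u2) by rewrite senorm_gt0 // subr_eq0.
set q := snrm (sgrad _ _ - _); have Sq : S (q / omega (snrm (u1 - u2)))%:E.
  by exists y, u1, u2.
by have := HM _ Sq; rewrite lee_fin ler_pdivrMr ?(modulus_gt0 omega_modulus).
Qed.

Lemma phi_differentiable y u : E y -> differentiable (phi y) u.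
Proof. by case: jet => _ pf _ _ /pf[_ []]. Qed.

Lemma phi_second_difference r : 0 < r -> exists2 M, 0 <= M &
  forall y (w v : subvs_of X), E y -> snrm (P y) <= 2 * r -> snrm w <= r -> snrm v <= r ->
    phi y (w + v) + phi y (w - v) - 2 * phi y w <= M * (snrm v * omega (snrm v)).
Proof.
move=> r0; have r20 : 0 < 2 * r by rewrite mulr_gt0.
have [M M0 HM] := phi_gradient_holder r20; exists (2 * M); first by rewrite mulr_ge0.
move=> y w v Ey yr wr vr.
have [s /andP[s0 s1] E2] := second_difference_mean_value w v
  (fun u => phi_differentiable u Ey).
have {}E2 := etrans E2 (congr2 (fun b c => b - c)
  (sub_gradientP _ _ _) (sub_gradientP _ _ _)).
rewrite {}E2 -sdotBl (le_trans (sdot_le_enorm _ _)) //.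
have sv : snrm (s *: v) <= snrm v.
  by rewrite senormZ gtr0_norm // ler_piMl ?senorm_ge0 // ltW.
have bnd1 : snrm (w + s *: v) <= 2 * r.
  by rewrite (le_trans (senormD _ _)) //; lra.
have bnd2 : snrm (w - s *: v) <= 2 * r.
  by rewrite (le_trans (senormB _ _)) //; lra.
move: (HM y _ _ Ey yr bnd1 bnd2); move: (snrm (sgrad (phi y) _ - _)) => D.
have -> : w + s *: v - (w - s *: v) = (2 * s) *: v.
  by rewrite opprB addrC addrA subrK -mulr2n mulr_natl scalerMnl.
move=> HG; have {}HG : D <= M * (2 * omega (snrm v)).
  apply: (le_trans HG); rewrite ler_wpM2l // senormZ gtr0_norm ?mulr_gt0 //.
  apply: le_trans (modulus_double omega_modulus omega_concave (senorm_ge0 v)).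
  apply: modulus_homo => //; first by rewrite !mulr_ge0 ?senorm_ge0 // ltW.
  by rewrite -mulrA ler_pM2l // ler_piMl ?senorm_ge0 // ltW.
apply: (le_trans (ler_wpM2r (senorm_ge0 v) HG)).
by rewrite le_eqVlt; apply/orP; left; apply/eqP; ring.
Qed.

(** Both [phi y] and its gradient vanish at [P y], so the mean value theorem from there and the
    bound on the oscillation of the gradient control [phi y] on balls. *)
Lemma phi_bounded y r : E y -> exists2 B, 0 <= B &
  forall u, snrm u <= r -> phi y u <= B.
Proof.
move=> Ey; case: (jet) => _ /(_ y Ey)[_ _ phi0 grad0] _ _.
have r0 : 0 < `|r| + snrm (P y) + 1 by rewrite ltr_wpDl // addr_ge0 // senorm_ge0.
have [M M0 HM] := phi_gradient_holder r0.
set r1 := `|r| + snrm (P y) + 1 in r0 HM.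
have Pyr : snrm (P y) <= r1 by rewrite /r1 -addrA addrCA lerDl addr_ge0.
exists (M * omega (2 * r1) * (2 * r1)).
  by rewrite !mulr_ge0 ?(modulus_ge0 omega_modulus) ?mulr_ge0 // ltW.
move=> u ur; have ur1 : snrm u <= r1.
  rewrite (le_trans ur) // (le_trans (ler_norm r)) // /r1 -addrA lerDl.
  by rewrite addr_ge0 // senorm_ge0.
set d := u - P y.
have dr : snrm d <= 2 * r1 by rewrite (le_trans (senormB _ _)) //; lra.
have [s /andP[s0 s1]] := mean_value (P y) d (fun u => phi_differentiable u Ey).
rewrite [P y + d]addrC /d subrK -/d phi0 subr0 => ->.
rewrite sub_gradientP (le_trans (sdot_le_enorm _ _)) //.
have sdd : snrm (s *: d) <= 2 * r1.
  by rewrite senormZ gtr0_norm // (le_trans _ dr) // ler_piMl ?senorm_ge0 // ltW.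
have zr : snrm (P y + s *: d) <= r1.
  have -> : P y + s *: d = (1 - s) *: P y + s *: u.
    by rewrite /d scalerBr scalerBl scale1r addrAC addrA.
  rewrite (le_trans (senormD _ _)) // !senormZ gtr0_norm ?subr_gt0 // gtr0_norm //.
  have A1 := ler_wpM2l (ltW s0) ur1.
  have A2 : (1 - s) * snrm (P y) <= (1 - s) * r1 by rewrite ler_wpM2l // subr_ge0 ltW.
  by move: A1 A2; lra.
apply: ler_pM => //; try exact: senorm_ge0.
have := HM y _ _ Ey Pyr zr Pyr.
rewrite grad0 subr0 [_ + _ - P y]addrAC subrr add0r => /le_trans; apply.
by rewrite ler_wpM2l // modulus_homo // senorm_ge0.
Qed.

Lemma cost_tangent_gap_bounded y r : E y -> exists2 B, 0 <= B &
  forall x, snrm (P x) <= r ->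
    phi y (P x) + a * theta omega (snrm (P (x - y))) <= B.
Proof.
move=> Ey; have [B B0 HB] := phi_bounded r Ey.
have r0 : 0 <= `|r| + snrm (P y) by rewrite addr_ge0 ?senorm_ge0.
exists (B + a * theta omega (`|r| + snrm (P y))).
  by rewrite addr_ge0 // mulr_ge0 ?(ltW a_gt0) // theta_ge0.
move=> x xr; rewrite lerD ?HB // ler_pM2l //.
apply: theta_homo; rewrite ?senorm_ge0 // orthprojB (le_trans (senormB _ _)) //.
by rewrite lerD2r (le_trans xr) // ler_norm.
Qed.

(** Here [T], [p], [h] are the tangent, [phi] and [theta] terms of a near-optimal [y], and [T0],
    [p0], [h0] those of a fixed [y0]. Domination of the tangent at [y0] by [T + p] leaves the excess
    to [h] alone. *)
Let near_optimal_gap (T p h T0 p0 h0 gw B : R) : T + p + h <= gw + 1 ->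
  T0 <= T + p -> gw <= T0 + p0 + h0 -> p0 + h0 <= B -> h <= B + 1.
Proof. lra. Qed.

Let cost_second_difference (g1 g2 g0 T1 T2 T p1 p2 p h1 h2 h e M W : R) :
  T1 + T2 = 2 * T -> g1 <= T1 + p1 + a * h1 -> g2 <= T2 + p2 + a * h2 ->
  p1 + p2 - 2 * p <= M * W -> h1 + h2 - 2 * h <= 4 * W ->
  T + p + a * h <= g0 + e / 2 -> g1 + g2 - 2 * g0 <= (M + 4 * a) * W + e.
Proof. by move=> ? ? ? ? /(ler_wpM2l (ltW a_gt0)) ? ?; lra. Qed.

(** One near-optimal [y] at [w] competes at both [w + v] and [w - v], so up to [e] the second
    difference of [g] is at most that of [cost y]: 0 from the tangent, [M] from [phi], [4 a] from
    the penalty. [M] is uniform because [P y] stays bounded. *)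
Lemma inf_cost_second_difference r : 0 < r -> exists2 C, 0 <= C &
  forall w v, snrm (P w) <= r -> snrm (P v) <= r ->
    g (w + v) + g (w - v) - 2 * g w <= C * (snrm (P v) * omega (snrm (P v))).
Proof.
move=> r0; have [y0 Ey0] := E_neq0.
have [B B0 HB] := cost_tangent_gap_bounded r Ey0.
have [K [K0 HK]] := theta_bounded omega_modulus omega_strict ((B + 1) / a).
have rK0 : 0 < r + K by rewrite ltr_pwDl.
have [M M0 HM] := phi_second_difference rK0.
exists (M + 4 * a); first by rewrite addr_ge0 // mulr_ge0 // ltW.
move=> w v wr vr; apply/ler_addgt0Pr => e e0.
have e20 : 0 < Num.min 1 (e / 2) by rewrite lt_min ltr01 divr_gt0.
have [y Ey Hy] := inf_cost_approx w e20.
have Hy1 : cost y w <= g w + 1 by rewrite (le_trans (ltW Hy)) // lerD2l ge_min lexx.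
have Hye : cost y w <= g w + e / 2.
  by rewrite (le_trans (ltW Hy)) // lerD2l ge_min lexx orbT.
have Kwy : snrm (P (w - y)) <= K.
  apply: HK; first exact: senorm_ge0.
  rewrite ler_pdivlMr // mulrC.
  case: jet => _ _ _ /(_ y0 y Ey0 Ey w) dom.
  exact: near_optimal_gap Hy1 dom (inf_cost_le w Ey0) (HB w wr).
have Pyr : snrm (P y) <= 2 * (r + K).
  have -> : P y = P w - P (w - y) by rewrite orthprojB subKr.
  by rewrite (le_trans (senormB _ _)) //; lra.
have H1 := inf_cost_le (w + v) Ey; have H2 := inf_cost_le (w - v) Ey.
have rK : r <= r + K by rewrite lerDl.
have H3 := HM y (P w) (P v) Ey Pyr (le_trans wr rK) (le_trans vr rK).
have H4 := theta_enorm_second_difference omega_modulus omega_concave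
  (vsval (P (w - y))) (vsval (P v)).
have E1 : nrm (vsval (P (w - y)) + vsval (P v)) = snrm (P (w + v - y)).
  by rewrite -vsvalD -orthprojD addrAC.
have E2 : nrm (vsval (P (w - y)) - vsval (P v)) = snrm (P (w - v - y)).
  by rewrite -vsvalB -orthprojB addrAC.
rewrite E1 E2 in H4.
have H5 : tangent y (w + v) + tangent y (w - v) = 2 * tangent y w.
  by rewrite /tangent !dotBr !dotDr; ring.
rewrite -orthprojD -orthprojB in H3.
exact: cost_second_difference H5 H1 H2 H3 H4 Hye.
Qed.

Lemma inf_cost_tangent_gap_bounded y r : E y -> exists2 B, 0 <= B &
  forall x, snrm (P x) <= r -> g x - tangent y x <= B.
Proof.
move=> Ey; have [B B0 HB] := cost_tangent_gap_bounded r Ey; exists B => // x xr.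
by rewrite lerBlDl (le_trans (inf_cost_le x Ey)) // /cost -addrA lerD2l HB.
Qed.

Lemma jet_envelope_le x : F x <= g x.
Proof.
have [z Ez] := E_neq0.
by apply: (envelope_le (tangent_convex z)) => w; exact: tangent_le_inf_cost.
Qed.

Let near_optimal (T : finType) (l : T -> R) (z : T -> 'rV[R]_n) x :=
  convex_combination l z x /\ \sum_i l i * g (z i) <= F x + 1.

(* [|b - c| = 2 max(b, c) - b - c], and both tangents lie below [g]. *)
Lemma tangent_gap_mass y1 y2 r : E y1 -> E y2 -> exists K, forall x,
  snrm (P x) <= r ->
  forall (T : finType) (l : T -> R) (z : T -> 'rV[R]_n), near_optimal l z x ->
  \sum_i l i * `|tangent y1 (z i) - tangent y2 (z i)| <= K.
Proof.
move=> Ey1 Ey2; have [B1 _ HB1] := inf_cost_tangent_gap_bounded r Ey1.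
have [B2 _ HB2] := inf_cost_tangent_gap_bounded r Ey2; exists (B1 + B2 + 2).
move=> x xr T l z [lzx val]; have [l0 l1 lx] := lzx.
have tangentE y : \sum_i l i * tangent y (z i) = tangent y x.
  have -> : tangent y x = (t y - dot (xi y) y) * \sum_i l i + dot (xi y) x.
    by rewrite l1 /tangent dotBr; ring.
  rewrite -(combination_dot _ lzx) mulr_sumr -big_split /=.
  by apply: eq_bigr => i _; rewrite /tangent dotBr; ring.
have bnd : \sum_i l i * `|tangent y1 (z i) - tangent y2 (z i)| <=
    2 * (\sum_i l i * g (z i)) - tangent y1 x - tangent y2 x.
  rewrite -!tangentE mulr_sumr -!sumrB; apply: ler_sum => i _.
  have -> : 2 * (l i * g (z i)) - l i * tangent y1 (z i) - l i * tangent y2 (z i) =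
    l i * (2 * g (z i) - tangent y1 (z i) - tangent y2 (z i)) by ring.
  rewrite ler_wpM2l //.
  have := tangent_le_inf_cost (z i) Ey1; have := tangent_le_inf_cost (z i) Ey2.
  by rewrite ler_norml; lra.
have := HB1 x xr; have := HB2 x xr; have := jet_envelope_le x; lra.
Qed.

(** The vectors [e] for which [<e, .>] has bounded first moment are closed under linear
    combinations. They include [xi y1 - xi y2], whose functional differs from a difference of
    tangents by a constant, and these vectors span [X]. *)
Lemma dot_mass e r : e \in X -> exists K, forall x, snrm (P x) <= r ->
  forall (T : finType) (l : T -> R) (z : T -> 'rV[R]_n), near_optimal l z x ->
  \sum_i l i * `|dot e (z i)| <= K.
Proof.
case: (jet) => spanX _ _ _ eX; have {eX} : e \in diff_span E xi by rewrite spanX.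
move: e; apply: vspan_ind => [|b u v [K1 H1] [K2 H2]|_ [y1 Ey1 [y2 Ey2 <-]]].
- by exists 0 => x _ T l z _; rewrite big1 // => i _; rewrite dot0 normr0 mulr0.
- exists (`|b| * K1 + K2) => x xr T l z lzx; have [[l0 _ _] _] := lzx.
  have := lerD (ler_wpM2l (normr_ge0 b) (H1 x xr T l z lzx)) (H2 x xr T l z lzx).
  apply: le_trans; rewrite mulr_sumr -big_split; apply: ler_sum => i _ /=.
  rewrite mulrCA -mulrDr ler_wpM2l // dotDl (le_trans (ler_normD _ _)) //.
  by rewrite normrM.
have [K HK] := tangent_gap_mass r Ey1 Ey2.
pose c := (t y2 - dot (xi y2) y2) - (t y1 - dot (xi y1) y1).
exists (K + `|c|) => x xr T l z lzx; have [[l0 l1 _] _] := lzx.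
rewrite -[`|c|]mul1r -[X in X * `|c|]l1 mulr_suml.
apply: le_trans _ (lerD (HK x xr T l z lzx) (lexx _)).
rewrite -big_split; apply: ler_sum => i _ /=; rewrite -mulrDr ler_wpM2l //.
apply: le_trans _ (ler_normD _ _); rewrite le_eqVlt; apply/orP; left; apply/eqP.
by congr (`|_|); rewrite dotBl /tangent !dotBr /c; ring.
Qed.

Lemma orthproj_mass r : exists2 K, 0 < K & forall x, snrm (P x) <= r ->
  forall (T : finType) (l : T -> R) (z : T -> 'rV[R]_n), near_optimal l z x ->
  \sum_i l i * snrm (P (z i)) <= K.
Proof.
have /choice[K HK] : forall j : 'I_n, exists K, forall x, snrm (P x) <= r ->
    forall (T : finType) (l : T -> R) (z : T -> 'rV[R]_n), near_optimal l z x ->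
    \sum_i l i * `|dot (vsval (P (delta_mx 0 j))) (z i)| <= K.
  by move=> j; apply: dot_mass; exact: subvsP.
exists (`|\sum_j K j| + 1); first by rewrite ltr_wpDl.
move=> x xr T l z lzx; have [[l0 _ _] _] := lzx.
apply: (@le_trans _ _ (\sum_j K j)); last first.
  by rewrite (le_trans (ler_norm _)) // lerDl.
apply: (@le_trans _ _
  (\sum_i l i * \sum_(j < n) `|dot (vsval (P (delta_mx 0 j))) (z i)|)).
  by apply: ler_sum => i _; rewrite ler_wpM2l // enorm_orthproj_le_sum.
under eq_bigr do rewrite mulr_sumr.
rewrite exchange_big /=; apply: ler_sum => j _; exact: HK lzx.
Qed.

Lemma jet_envelope_second_difference r : 0 < r -> exists2 C, 0 <= C &
  forall x v, nrm x <= r -> nrm v <= r ->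
    F (x + v) + F (x - v) - 2 * F x <= C * (nrm v * omega (nrm v)).
Proof.
move=> r0; have [z0 Ez0] := E_neq0.
have [K K0 HK] := orthproj_mass r.
(* The moved points satisfy [|P w| <= 2 K] and the displacements [|s v| <= 2 r]; one radius covers
   both. As [s <= 2], both [|s v|] and its modulus at most double, hence [4 C]. *)
have rK : 0 < 2 * (r + K) by rewrite mulr_gt0 // addr_gt0.
have [C C0 HC] := inf_cost_second_difference rK; exists (4 * C); first by rewrite mulr_ge0.
move=> x v xr vr; have v0 := enorm_ge0 v.
have om0 := modulus_ge0 omega_modulus v0.
apply: (@envelope_second_difference _ _ _ _ (tangent_convex z0)
  (fun x => tangent_le_inf_cost x Ez0) (fun w => snrm (P w)) x v K).
- by move=> w; exact: senorm_ge0.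
- exact: K0.
- by rewrite !mulr_ge0.
- move=> T l z lzx val; apply: HK (conj lzx val).
  by rewrite (le_trans (enorm_orthproj _ _)).
move=> w s wK s1 s2; have s0 : 0 <= s by rewrite (le_trans _ s1).
have sv : snrm (P (s *: v)) <= 2 * nrm v.
  rewrite (le_trans (enorm_orthproj _ _)) // enormZ ger0_norm //.
  by rewrite ler_wpM2r.
have := HC w (s *: v).
have -> : snrm (P w) <= 2 * (r + K) by rewrite (le_trans wK) // ler_pM2l // lerDr ltW.
have -> : snrm (P (s *: v)) <= 2 * (r + K).
  by rewrite (le_trans sv) // ler_pM2l // (le_trans vr) // lerDl ltW.
move=> /(_ isT isT) /le_trans; apply.
have om2 : omega (snrm (P (s *: v))) <= 2 * omega (nrm v).
  rewrite (le_trans _ (modulus_double omega_modulus omega_concave v0)) //.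
  by rewrite modulus_homo // senorm_ge0.
have := ler_pM (senorm_ge0 _) (modulus_ge0 omega_modulus (senorm_ge0 _)) sv om2.
move=> /(ler_wpM2l C0) /le_trans; apply.
by rewrite le_eqVlt; apply/orP; left; apply/eqP; ring.
Qed.

(** [F] is squeezed between [tangent y], a convex minorant of [g], and [cost y]; both equal [t y] at
    [y]. *)
Lemma jet_envelope_eq y : E y -> F y = t y.
Proof.
move=> Ey; apply/le_anti/andP; split.
  rewrite (le_trans (jet_envelope_le y)) // (le_trans (inf_cost_le y Ey)) //.
  case: jet => _ /(_ y Ey)[_ _ phi0 _] _ _.
  by rewrite /cost /tangent subrr dot0r phi0 linear0 senorm0 theta0 mulr0 !addr0.
have := envelope_ge y (tangent_convex y) (fun x => tangent_le_inf_cost x Ey).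
by rewrite {1}/tangent subrr dot0r addr0.
Qed.

Lemma jet_envelope_subgradient y : E y -> subdifferential F y (xi y).
Proof.
move=> Ey z; rewrite jet_envelope_eq //.
exact: (envelope_ge z (tangent_convex y) (fun x => tangent_le_inf_cost x Ey)).
Qed.

Lemma xi_perp y1 y2 v : E y1 -> E y2 -> P v = 0 -> dot (xi y1) v = dot (xi y2) v.
Proof.
move=> Ey1 Ey2 Pv; apply/eqP; rewrite -subr_eq0 -dotBl.
have eX : xi y1 - xi y2 \in X.
  have spanX : diff_span E xi = X by case: jet.
  suff : xi y1 - xi y2 \in diff_span E xi by rewrite spanX.
  by apply: (vspanP _).1; exists y1 => //; exists y2.
by rewrite -(vsprojK eX) dotC -sdot_orthproj Pv /sdot dot0.
Qed.

(** Along the kernel of [P] only the tangent term of [cost y] moves, by an amount independent of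
    [y]. One inequality suffices, since [- v] is in the kernel too. *)
Lemma inf_cost_translation_perp y0 z v : E y0 -> P v = 0 -> g (z + v) <= g z + dot (xi y0) v.
Proof.
move=> Ey0 Pv; apply/ler_addgt0Pr => e e0.
have [y Ey Hy] := inf_cost_approx z e0; have := inf_cost_le (z + v) Ey.
rewrite (xi_perp Ey0 Ey Pv) => /le_trans; apply.
suff -> : cost y (z + v) = cost y z + dot (xi y) v by move: (ltW Hy); lra.
rewrite /cost /tangent !orthprojB orthprojD Pv addr0 !dotBr dotDr.
by ring.
Qed.

Lemma jet_envelope_translation_perp y0 x v : E y0 -> P v = 0 -> F (x + v) <= F x + dot (xi y0) v.
Proof.
move=> Ey0 Pv; apply/ler_addgt0Pr => e e0.
have [T [l [z [lzx val]]]] := envelope_approx (tangent_convex y0)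
  (fun x => tangent_le_inf_cost x Ey0) x e0.
have [l0 l1 _] := lzx.
have lv : \sum_i l i *: v = v by rewrite -scaler_suml l1 scale1r.
have := envelope_le_shift (tangent_convex y0) (fun x => tangent_le_inf_cost x Ey0) lzx lv.
move=> /le_trans; apply.
apply: (@le_trans _ _ (\sum_i l i * (g (z i) + dot (xi y0) v))).
  by apply: ler_sum => i _; rewrite ler_wpM2l // inf_cost_translation_perp.
under eq_bigr do rewrite mulrDr.
by rewrite big_split /= -mulr_suml l1 mul1r addrAC lerD2r.
Qed.

Lemma jet_envelope_subdifferential_mem y0 x (u : 'rV[R]_n) :
  E y0 -> subdifferential F x u -> u - xi y0 \in X.
Proof.
move=> Ey0 uF.
have le_xi v : P v = 0 -> dot u v <= dot (xi y0) v.
  move=> Pv; have := uF (x + v); rewrite [_ + _ - x]addrAC subrr add0r.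
  by have := jet_envelope_translation_perp x Ey0 Pv; lra.
apply: orthproj_perp_mem => v Pv; rewrite dotBl.
have PNv : P (- v) = 0 by rewrite -scaleN1r orthprojZ Pv scaler0.
by have := le_xi _ PNv; have := le_xi _ Pv; rewrite !dotNr; lra.
Qed.

Lemma jet_extension : is_extension omega X E t xi F.
Proof.
have [y0 Ey0] := E_neq0.
have cF : convex_fun F.
  exact: (envelope_convex (tangent_convex y0) (fun x => tangent_le_inf_cost x Ey0)).
have C1F : C1omega_loc (@dot R n) omega F.
  exact: (second_difference_C1omega_loc omega_modulus omega_concave cF
    jet_envelope_second_difference).
split=> // [|y Ey|]; first exact: jet_envelope_eq.
  by apply/esym; apply: subdifferential_gradient (C1F.1 y) (jet_envelope_subgradient Ey).
apply: (vspan_unique (vspanP _)); split=> [_ [x [y [u [w [ux wy ->]]]]]|W HW].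
  have -> : u - w = (u - xi y0) - (w - xi y0) by rewrite opprB addrA subrK.
  exact: memvB (jet_envelope_subdifferential_mem Ey0 ux) (jet_envelope_subdifferential_mem Ey0 wy).
have spanX : diff_span E xi = X by case: jet.
suff : (diff_span E xi <= W)%VS by rewrite spanX.
apply: (vspanP _).2 => _ [y Ey [z Ez <-]].
by apply: HW; exists y, z, (xi y), (xi z); split=> //; exact: jet_envelope_subgradient.
Qed.

End JetExtension.

(** * The jet of a convex function *)

Section JetOfFunction.
Variables (R : realType) (n : nat) (omega : R -> R).
Hypothesis omega_modulus : modulus_of_continuity omega.
Hypothesis omega_strict : {in `[0, +oo[ &, {homo omega : s t / s < t}}.
Variables (X : {vspace 'rV[R]_n}) (F : 'rV[R]_n -> R).
Hypotheses (cF : convex_fun F) (C1F : C1omega_loc (@dot R n) omega F).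
Hypothesis spanF : X_of F = X.

Local Notation nrm := (enorm (@dot R n)).
Local Notation snrm := (enorm (@sdot R n X)).
Local Notation grad := (gradient (@dot R n)).
Local Notation P := (orthproj X).
Implicit Types (x y z v w : 'rV[R]_n).

Let dF x : differentiable F x := C1F.1 x.

Lemma gradient_subdifferential x : subdifferential F x (grad F x).
Proof. by move=> z; exact: convex_gradient_le. Qed.

Lemma gradientB_mem x y : grad F x - grad F y \in X.
Proof.
suff : grad F x - grad F y \in X_of F by rewrite spanF.
apply: (vspanP _).1; exists x, y, (grad F x), (grad F y).
by split=> //; exact: gradient_subdifferential.
Qed.

Lemma gradient_span (U : {vspace 'rV[R]_n}) :
  (forall x y, grad F x - grad F y \in U) -> (X <= U)%VS.
Proof.
move=> HU; suff : (X_of F <= U)%VS by rewrite spanF.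
apply: (vspanP _).2 => _ [x [y [u [w [ux wy ->]]]]].
by rewrite (subdifferential_gradient (dF x) ux) (subdifferential_gradient (dF y) wy).
Qed.

Lemma translation_perp y z v : P v = 0 -> F (z + v) = F z + dot (grad F y) v.
Proof.
move=> Pv; have [s _ E] := mean_value z v dF.
have H : dot (grad F (z + s *: v)) v = dot (grad F y) v.
  apply/eqP; rewrite -subr_eq0 -dotBl.
  rewrite -(vsprojK (gradientB_mem (z + s *: v) y)).
  by rewrite dotC -sdot_orthproj Pv /sdot dot0.
have {}E := etrans E (etrans (rV_gradientP _ _ _) H).
by rewrite -E subrKC.
Qed.

Lemma orthproj_residue y : P (y - vsval (P y)) = 0.
Proof. by rewrite orthprojB orthproj_id subrr. Qed.

(** Translating the subgradient inequality at [y] along [y - P y] makes [grad F y] a subgradient at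
    [P y], where differentiability leaves only one. *)
Lemma gradient_orthproj y : grad F (vsval (P y)) = grad F y.
Proof.
apply/esym; apply: (subdifferential_gradient (dF _)) => z.
set v := y - vsval (P y).
have Pv : P v = 0 := orthproj_residue y.
have := gradient_subdifferential y (z + v).
rewrite (translation_perp y z Pv).
have Ey : F y = F (vsval (P y)) + dot (grad F y) v.
  by rewrite -(translation_perp y _ Pv) /v subrKC.
have -> : z + v - y = z - vsval (P y) by rewrite /v addrA addrAC addrK.
by rewrite Ey; lra.
Qed.

Lemma jet_of_function (E : set 'rV[R]_n) t (xi : 'rV[R]_n -> 'rV[R]_n) :
    (forall y, E y -> t y = F y) -> (forall y, E y -> xi y = grad F y) ->
    diff_span E xi = X ->
  exists phi : 'rV[R]_n -> subvs_of X -> R, jet_condition omega E t xi phi.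
Proof.
move=> tE xiE spanE.
pose c y := F (vsval (P y)) - dot (grad F y) (vsval (P y)).
pose phi y (u : subvs_of X) := F (vsval u) - c y - dot (grad F y) (vsval u).
have phiG y (u : subvs_of X) := restriction_gradient (grad F y) (c y) u dF.
have gradB y u1 u2 : gradient (@sdot R n X) (phi y) u1 -
    gradient (@sdot R n X) (phi y) u2 =
    P (grad F (vsval u1) - grad F (vsval u2)).
  rewrite (phiG y u1).2 (phiG y u2).2 -orthprojB; congr (P _).
  by rewrite opprB addrA subrK.
have bound y u1 u2 M : nrm (grad F (vsval u1) - grad F (vsval u2)) <=
    M * omega (nrm (vsval u1 - vsval u2)) ->
    snrm (gradient (@sdot R n X) (phi y) u1 - gradient (@sdot R n X) (phi y) u2)
      <= M * omega (snrm (u1 - u2)).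
  rewrite -vsvalB => H; rewrite gradB (le_trans (enorm_orthproj _ _)) //.
exists phi; split=> //.
- move=> y Ey; split.
  + move=> u; have := gradient_subdifferential (vsval (P y)) (vsval u).
    by rewrite gradient_orthproj dotBr /phi /c; lra.
  + split=> [u|u0 r]; first exact: (phiG y u).1.
    have [M HM] := C1F.2 (vsval u0) r; exists M => u1 u2 h1 h2.
    apply: bound; apply: HM; rewrite -vsvalB; [exact: h1|exact: h2].
  + by rewrite /phi /c; ring.
  + by rewrite (phiG y (P y)).2 gradient_orthproj subrr linear0.
- move=> r r0; have [M HM] := C1F.2 0 r.
  apply: (@le_lt_trans _ _ M%:E); last exact: ltry.
  apply: ge_ereal_sup => _ [y [u1 [u2 [[_ _] h1 h2 u12 ->]]]].
  have n12 : 0 < snrm (u1 - u2) by rewrite senorm_gt0 // subr_eq0.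
  rewrite lee_fin ler_pdivrMr ?(modulus_gt0 omega_modulus) //.
  by apply: bound; apply: HM; rewrite subr0.
(* The right side is exactly [F x], since [F] is affine along the kernel from [P x] to [x] and from
   [P y] to [y]; what remains is the subgradient inequality at [z]. *)
- move=> z y Ez Ey x; rewrite (tE z Ez) (xiE z Ez) (tE y Ey) (xiE y Ey).
  rewrite (le_trans (gradient_subdifferential z x)) // le_eqVlt; apply/orP; left.
  apply/eqP; rewrite /phi /c !dotBr.
  have Px := translation_perp y (vsval (P x)) (orthproj_residue x).
  have Py := translation_perp y (vsval (P y)) (orthproj_residue y).
  move: Px Py; rewrite ![vsval _ + _]addrC !subrK !dotBr => -> ->; ring.
Qed.

(** Induction on the missing dimension: if every [grad F p - grad F y0] were in [U], then [X] would
    be contained in [U]; so some [p] adds one dimension. The last clause, about the initial [U],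
    keeps the points off [E]. *)
Lemma gradient_points y0 (U : {vspace 'rV[R]_n}) : (U <= X)%VS ->
  exists s : seq 'rV[R]_n, [/\ size s = (\dim X - \dim U)%N,
    (U + <<[seq grad F p - grad F y0 | p <- s]>>)%VS = X &
    forall p, p \in s -> grad F p - grad F y0 \notin U].
Proof.
move: {2}(_ - _)%N (erefl (\dim X - \dim U)%N) => k.
elim: k U => [|k IHk] U dimU UX.
  exists [::]; rewrite span_nil addv0; split => //.
  by apply/eqP; rewrite eqEdim UX -subn_eq0 dimU.
have [p pU] : exists p, grad F p - grad F y0 \notin U.
  apply: contrapT => /forallNP H.
  have : (X <= U)%VS.
    apply: gradient_span => x y.
    have -> : grad F x - grad F y = (grad F x - grad F y0) - (grad F y - grad F y0).
      by rewrite opprB addrA subrK.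
    by apply: memvB; apply: contrapT => /negP; exact: H.
  by move=> /dimvS; rewrite -subn_eq0 dimU.
set v := grad F p - grad F y0 in pU.
have UvX : (U + <[v]> <= X)%VS.
  by rewrite subv_add UX -memvE gradientB_mem.
have dimUv : \dim (U + <[v]>) = (\dim U).+1.
  have := dimv_sum_cap U <[v]>; rewrite dim_vline.
  have -> : v != 0 by apply: contraNneq pU => ->; rewrite mem0v.
  have -> : (U :&: <[v]>)%VS = 0%VS.
    apply/eqP; rewrite -subv0; apply/subvP => w.
    rewrite memv_cap memv0 => /andP[wU /vlineP[b wE]]; rewrite wE.
    have [->|b0] := eqVneq b 0; first by rewrite scale0r.
    by move: wU; rewrite wE rpredZeq (negPf b0) (negPf pU).
  by rewrite dimv0 addn0 addn1.
have [|s [sz sX sU]] := IHk _ _ UvX; first by rewrite dimUv subnS dimU.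
exists (p :: s); split => [/=||q].
- by rewrite sz dimUv subnS dimU.
- by rewrite /= span_cons addvA.
- rewrite inE => /predU1P[->//|/sU]; apply: contra; exact: subvP (addvSl _ _) _.
Qed.

End JetOfFunction.

(** * Data at the added points, and the theorem *)

Section ExtendData.
Variables (R : realType) (n : nat).
Variables (T : Type) (m : nat) (E : set 'rV[R]_n) (f : 'rV[R]_n -> T).
Variables (p : 'I_m -> 'rV[R]_n).

Lemma extend_data_in b y : E y -> extend_data E f p b y = f y.
Proof. by move=> Ey; rewrite /extend_data mem_set. Qed.

(** If the added data are values of one function [h], the index found by [pick] does not matter. *)
Lemma extend_data_comp (h : 'rV[R]_n -> T) y : (forall y, E y -> f y = h y) ->
  (E `|` range p) y -> extend_data E f p (h \o p) y = h y.
Proof.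
move=> fh; rewrite /extend_data; case: ifPn => [/set_mem Ey _|yE]; first exact: fh.
case=> [/mem_set|[j _ <-]]; first by rewrite (negPf yE).
by case: pickP => [i /eqP /= ->//|/(_ j)]; rewrite eqxx.
Qed.

End ExtendData.

Lemma is_extension_subset (R : realType) (n : nat) (omega : R -> R)
    (X : {vspace 'rV[R]_n}) (E E' : set 'rV[R]_n) (f f' : 'rV[R]_n -> R)
    (G G' : 'rV[R]_n -> 'rV[R]_n) (F : 'rV[R]_n -> R) :
    E `<=` E' -> {in E, f' =1 f} -> {in E, G' =1 G} ->
  is_extension omega X E' f' G' F -> is_extension omega X E f G F.
Proof.
move=> EE' ff' GG' [cF C1F Ff FG XF]; split=> // y Ey.
  by rewrite Ff ?ff' ?inE //; exact: EE'.
by rewrite FG ?GG' ?inE //; exact: EE'.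
Qed.

Theorem theorem2p3 (R : realType) (n : nat) (omega : R -> R)
    (omega_modulus : modulus_of_continuity omega)
    (omega_concave : concave_modulus omega)
    (omega_strict : {in `[0, +oo[ &, {homo omega : s t / s < t}})
    (omega_infty : omega t @[t --> +oo] --> +oo)
    (E : set 'rV[R]_n) (E_neq0 : E !=set0) (X : {vspace 'rV[R]_n})
    (f : 'rV[R]_n -> R) (G : 'rV[R]_n -> 'rV[R]_n) :
  let Y := diff_span E G in
  let k : nat := \dim Y in
  let d : nat := \dim X in
  ((exists F : 'rV[R]_n -> R, is_extension omega X E f G F) <->
   [/\ (* (i) *) (Y <= X)%VS,
       (* (ii) *) (k < d)%N ->
         exists (p : 'I_(d - k) -> 'rV[R]_n) (beta : 'I_(d - k) -> R)
                (w : 'I_(d - k) -> 'rV[R]_n),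
           (forall j, ~ E (p j)) /\
           exists phi : 'rV[R]_n -> subvs_of X -> R,
             jet_condition omega (E `|` range p)
               (extend_data E f p beta) (extend_data E G p w) phi
     & (* (iii) *) k = d ->
         exists phi : 'rV[R]_n -> subvs_of X -> R,
           jet_condition omega E f G phi]) /\
  ((Y <= X)%VS ->
   ((k < d)%N ->
      forall (p : 'I_(d - k) -> 'rV[R]_n) (beta : 'I_(d - k) -> R)
             (w : 'I_(d - k) -> 'rV[R]_n)
             (phi : 'rV[R]_n -> subvs_of X -> R),
        (forall j, ~ E (p j)) ->
        jet_condition omega (E `|` range p)
          (extend_data E f p beta) (extend_data E G p w) phi ->
        forall a : R, 0 < a ->
          is_extension omega X E f G
            (extension_formula omega (E `|` range p)
               (extend_data E f p beta) (extend_data E G p w) phi a)) /\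
   (k = d ->
      forall phi : 'rV[R]_n -> subvs_of X -> R,
        jet_condition omega E f G phi ->
        forall a : R, 0 < a ->
          is_extension omega X E f G (extension_formula omega E f G phi a))).
Proof.
move=> Y k d; split; [split=> [[F [cF C1F Ff FG XF]]|[YX ii iii]]|move=> YX; split].
- have GE y : E y -> G y = gradient (@dot R n) F y by move=> /FG.
  have fE y : E y -> f y = F y by move=> /Ff.
  have YX : (Y <= X)%VS.
    apply: (vspanP _).2 => _ [y Ey [z Ez <-]]; rewrite (GE y Ey) (GE z Ez).
    exact: (gradientB_mem cF C1F XF).
  split=> // [kd|kd].
    have [y0 Ey0] := E_neq0.
    have [s [sz sX sY]] := gradient_points cF C1F XF y0 YX.
    (* [s] has exactly [d - k] elements, so the default 0 is never read. *)
    pose p (j : 'I_(d - k)) := nth 0 s j.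
    have ps j : p j \in s by rewrite mem_nth // sz.
    exists p, (F \o p), (gradient (@dot R n) F \o p); split=> [j Ep|].
      (* If [p j] were in [E], its gradient difference with [y0] would lie in [Y]. *)
      have := sY _ (ps j); rewrite -(GE _ Ep) -(GE _ Ey0) => /negP; apply.
      by apply: (vspanP _).1; exists (p j) => //; exists y0.
    have FE y := extend_data_comp (y := y) (p := p) fE.
    have FG' y := extend_data_comp (y := y) (p := p) GE.
    apply: (jet_of_function omega_modulus omega_strict cF C1F XF FE FG').
    set E' := E `|` range p in FE FG' *.
    set xi := extend_data E G p _ in FG' *.
    apply: (vspan_unique (vspanP _)); split=> [_ [y Ey [z Ez <-]]|W HW].
      by rewrite (FG' y Ey) (FG' z Ez); exact: (gradientB_mem cF C1F XF).
    have EE' y : E y -> E' y by left.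
    rewrite -sX subv_add; apply/andP; split.
      apply: (vspanP _).2 => _ [y Ey [z Ez <-]]; apply: HW.
      exists y; first exact: EE'.
      exists z; first exact: EE'.
      by rewrite (FG' _ (EE' _ Ey)) (FG' _ (EE' _ Ez)) (GE y Ey) (GE z Ez).
    apply/span_subvP => _ /mapP[q qs ->]; apply: HW.
    have Eq : E' q.
      right; have qi : (index q s < d - k)%N by rewrite -sz index_mem.
      by exists (Ordinal qi) => //; rewrite /p /= nth_index.
    exists q => //; exists y0; first exact: EE'.
    by rewrite (FG' _ Eq) (FG' _ (EE' _ Ey0)).
  have YXe : Y = X by apply/eqP; rewrite eqEdim YX; exact: eq_leq (esym kd).
  exact: (jet_of_function omega_modulus omega_strict cF C1F XF fE GE YXe).
- have [kd|kd] := ltnP k d.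
    have [p [beta [w [_ [phi jet]]]]] := ii kd.
    exists (extension_formula omega (E `|` range p)
      (extend_data E f p beta) (extend_data E G p w) phi 1).
    have E'0 : (E `|` range p) !=set0 by have [y Ey] := E_neq0; exists y; left.
    have := jet_extension omega_modulus omega_concave omega_strict E'0 ltr01 jet.
    apply: is_extension_subset => [y Ey|y /set_mem Ey|y /set_mem Ey].
    + by left.
    + exact: extend_data_in.
    + exact: extend_data_in.
  have kde : k = d by apply/eqP; rewrite eqn_leq kd andbT dimvS.
  have [phi jet] := iii kde; exists (extension_formula omega E f G phi 1).
  exact: jet_extension.
- move=> _ p beta w phi _ jet a a0.
  have E'0 : (E `|` range p) !=set0 by have [y Ey] := E_neq0; exists y; left.
  have := jet_extension omega_modulus omega_concave omega_strict E'0 a0 jet.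
  apply: is_extension_subset => [y Ey|y /set_mem Ey|y /set_mem Ey].
  + by left.
  + exact: extend_data_in.
  + exact: extend_data_in.
- by move=> _ phi jet a a0; exact: jet_extension.
Qed.
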